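(* Fix $\alpha\in(0,1)$ and, for $n\in\mathbb N$, let $J_{n,\alpha}$ be the semi-infinite discrete Schrödinger operator $J_{n,\alpha}:=J_0+i\,n^{-\alpha}\,\mathcal P_n$ on $\ell^2(\mathbb N)$. Then there is a constant $C>0$, independent of $n$, such that for all large enough $n$ $$\frac1{\|J_{n,\alpha}-J_0\|_1}\sum_{\lambda\in\sigma_d(J_{n,\alpha})}\frac{\operatorname{dist}(\lambda,[-2,2])}{|\lambda^2-4|^{1/2}}\ge C\log n .$$ In particular, $$\lim_{n\to\infty}\frac1{\|J_{n,\alpha}-J_0\|_1}\sum_{\lambda\in\sigma_d(J_{n,\alpha})}\frac{\operatorname{dist}(\lambda,[-2,2])}{|\lambda^2-4|^{1/2}}=+\infty .$$
   Context: $\mathbb N=\{1,2,\dots\}$. $J_0$ is the half-line discrete Laplacian on $\ell^2(\mathbb N)$: the tridiagonal matrix with zeros on the diagonal and ones on the sub- and superdiagonals. $\mathcal P_n$ is the orthogonal projection of $\ell^2(\mathbb N)$ onto the linear span of the first $n$ standard basis vectors $e_1,\dots,e_n$. Thus $J_{n,\alpha}$ is the tridiagonal matrix with off-diagonal entries $1$ and diagonal entries $b_j=i\,n^{-\alpha}$ for $1\le j\le n$, $b_j=0$ for $j\ge n+1$. $\|\cdot\|_1$ is the trace norm. The discrete spectrum $\sigma_d(\cdot)$ is the set of isolated eigenvalues of finite algebraic multiplicity (it lies in $\mathbb C\setminus[-2,2]$). *)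

(* Defs.v *)
From HB Require Import structures.
From mathcomp Require Import all_boot all_order all_algebra.
From mathcomp Require Import all_classical all_reals all_analysis.
From mathcomp Require Import complex ring lra.
Set Implicit Arguments.
Unset Strict Implicit.
Unset Printing Implicit Defensive.
Import Order.TTheory GRing.Theory Num.Theory.
Import numFieldNormedType.Exports.
Import ComplexField.Normc.
Local Open Scope classical_set_scope.
Local Open Scope ring_scope.
Local Open Scope complex_scope.

(* [R[i]] itself carries an [R]-module structure; the regular algebra [R[i]^o]
   provides the scaling by complex numbers and the usual topology of C. *)
Local Notation C R := (R[i]^o).

Section SequenceSpace.
Context {R : realType}.
Implicit Types u v : nat -> C R.

Definition sqnorm u : \bar R := (\sum_(0 <= k <oo) (normc (u k) ^+ 2)%:E)%E.

Definition square_summable : {pred nat -> C R} :=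
  fun u => (sqnorm u < +oo)%E.

Lemma normc_sqrD (a b : R[i]) :
  normc (a + b) ^+ 2 <= 2 * normc a ^+ 2 + 2 * normc b ^+ 2.
Proof.
have h x y : Num.sqrt (x ^+ 2 + y ^+ 2) ^+ 2 = x ^+ 2 + y ^+ 2 :> R.
  by rewrite sqr_sqrtr// addr_ge0// sqr_ge0.
case: a b => [a1 a2] [b1 b2]; rewrite /= !h.
have := sqr_ge0 (a1 - b1); have := sqr_ge0 (a2 - b2); nra.
Qed.

Lemma sqnorm_term_ge0 u k : (0 <= (normc (u k) ^+ 2)%:E :> \bar R)%E.
Proof. by rewrite lee_fin sqr_ge0. Qed.

Lemma sqnorm_recl u :
  sqnorm u = ((normc (u 0%N) ^+ 2)%:E + sqnorm (fun k => u k.+1))%E.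
Proof.
rewrite /sqnorm nneseries_recl//; last by move=> k _; exact: sqnorm_term_ge0.
rewrite -(nneseries_addn 1); last by move=> k; exact: sqnorm_term_ge0.
by congr (_ + _)%E; apply: eq_eseriesr => i _; rewrite addn1.
Qed.

Lemma square_summable_lincomb (a b : R) u v w :
    u \in square_summable -> v \in square_summable -> 0 <= a -> 0 <= b ->
    (forall k, normc (w k) ^+ 2 <= a * normc (u k) ^+ 2 + b * normc (v k) ^+ 2) ->
  w \in square_summable.
Proof.
rewrite !unfold_in /sqnorm => su sv a0 b0 wle.
apply: (@le_lt_trans _ _ (\sum_(0 <= k <oo)
  (a%:E * (normc (u k) ^+ 2)%:E + b%:E * (normc (v k) ^+ 2)%:E))%E).
  apply: lee_nneseries => k *; first exact: sqnorm_term_ge0.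
  by rewrite -!EFinM -EFinD lee_fin.
rewrite nneseriesD; last 2 first.
- by move=> k *; rewrite mule_ge0// lee_fin// sqr_ge0.
- by move=> k *; rewrite mule_ge0// lee_fin// sqr_ge0.
rewrite !nneseriesZl//; try by move=> k *; exact: sqnorm_term_ge0.
by rewrite lte_add_pinfty// lte_mul_pinfty// nneseries_ge0// => k *;
  exact: sqnorm_term_ge0.
Qed.

Lemma square_summable_submod_closed : submod_closed square_summable.
Proof.
split.
  rewrite unfold_in /sqnorm eseries0 ?ltry// => k _ _.
  by rewrite [_ k]/= (@normc0 R) expr0n.
move=> a u v su sv.
apply: (@square_summable_lincomb (2 * normc a ^+ 2) 2 u v) => //.
  by rewrite mulr_ge0// sqr_ge0.
by move=> k; rewrite -mulrA -exprMn -normcM; exact: normc_sqrD.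
Qed.

HB.instance Definition _ := GRing.isSubmodClosed.Build _ _ square_summable
  square_summable_submod_closed.

End SequenceSpace.

(* The index k stands for the basis vector e_{k+1}. *)
Record l2 (R : realType) := L2 {
  l2_val :> nat -> C R;
  _ : l2_val \in square_summable }.

HB.instance Definition _ (R : realType) := [isSub for @l2_val R].
HB.instance Definition _ (R : realType) := [Choice of l2 R by <:].
HB.instance Definition _ (R : realType) := [SubChoice_isSubLmodule of l2 R by <:].

Section Operators.
Context {R : realType}.
Implicit Types (u v : l2 R) (z : C R).

Definition l2norm u : R := Num.sqrt (fine (sqnorm u)).

Definition inner u v : C R := limn (series (fun k => u k * (v k)^* : C R)).

Lemma std_basis_subproof k : (fun j => (j == k)%:R : C R) \in square_summable.
Proof.
rewrite unfold_in /sqnorm (@nneseries_split _ _ 0 k.+1)//; last first.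
  by move=> j _; exact: sqnorm_term_ge0.
rewrite [X in (_ + X)%E]eseries0 ?adde0 ?sumEFin ?ltry// => j kj _.
by rewrite gtn_eqF// (@normc0 R) expr0n.
Qed.

Definition std_basis k : l2 R := L2 (std_basis_subproof k).

Lemma laplacian_subproof u :
  (fun k => (if k is j.+1 then u j else 0) + u k.+1 : C R) \in square_summable.
Proof.
have su : l2_val u \in square_summable by exact: (valP u).
apply: (@square_summable_lincomb _ 2 2
  (fun k => if k is j.+1 then u j else 0) (fun k => u k.+1)) => //; last first.
- by move=> k; exact: normc_sqrD.
- move: su; rewrite !unfold_in sqnorm_recl.
  by apply: le_lt_trans; rewrite leeDr// sqnorm_term_ge0.
- by rewrite unfold_in sqnorm_recl [normc _](@normc0 R) expr0n add0e.
Qed.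

Definition laplacian u : l2 R := L2 (laplacian_subproof u).

Lemma laplacian_linear : linear laplacian.
Proof.
move=> a u v; apply/val_inj/funext => -[|k].
- rewrite -[LHS]/(0 + (a * u 1 + v 1)) -[RHS]/(a * (0 + u 1) + (0 + v 1)).
  by rewrite !add0r.
- rewrite -[LHS]/(a * u k + v k + (a * u k.+2 + v k.+2)).
  rewrite -[RHS]/(a * (u k + u k.+2) + (v k + v k.+2)).
  by rewrite mulrDr addrACA.
Qed.

HB.instance Definition _ :=
  GRing.isLinear.Build _ _ _ _ laplacian laplacian_linear.

Lemma proj_subproof n u :
  (fun k => if (k < n)%N then u k else 0 : C R) \in square_summable.
Proof.
have su : l2_val u \in square_summable by exact: (valP u).
apply: (square_summable_lincomb (a := 1) (b := 0) su su) => // k.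
by rewrite mul1r mul0r addr0; case: ifP => // _; rewrite (@normc0 R) expr0n sqr_ge0.
Qed.

Definition proj n u : l2 R := L2 (proj_subproof n u).

Lemma proj_linear n : linear (proj n).
Proof.
move=> a u v; apply/val_inj/funext => k.
rewrite -[LHS]/(if (k < n)%N then a * u k + v k else 0).
rewrite -[RHS]/(a * (if (k < n)%N then u k else 0)
               + if (k < n)%N then v k else 0).
by case: ifP => // _; rewrite mulr0 addr0.
Qed.

HB.instance Definition _ n :=
  GRing.isLinear.Build _ _ _ _ (proj n) (proj_linear n).

Definition bounded_op (T : l2 R -> l2 R) :=
  exists M : R, forall u, l2norm (T u) <= M * l2norm u.

Definition positive_op (T : l2 R -> l2 R) := forall u, 0 <= inner (T u) u.

(* For a bounded linear [T] the only such [A] is |T|, the positive square root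
   of T^*T. The last clause says A^2 = T^*T. *)
Definition is_abs_op (T A : l2 R -> l2 R) :=
  [/\ linear A, bounded_op A, positive_op A &
    forall u v, inner (A (A u)) v = inner (T u) (T v)].

Definition abs_op (T : l2 R -> l2 R) : l2 R -> l2 R :=
  xget (fun=> 0) [set A | is_abs_op T A].

Definition trace_norm (T : l2 R -> l2 R) : \bar R :=
  (\sum_(0 <= k <oo)
     (complex.Re (inner (abs_op T (std_basis k)) (std_basis k)))%:E)%E.

Definition shift_op (T : l2 R -> l2 R) z : l2 R -> l2 R := fun u => T u - z *: u.

Definition resolvent_set (T : {linear l2 R -> l2 R}) : set (C R) :=
  [set z | exists S : l2 R -> l2 R,
    [/\ bounded_op S, cancel (shift_op T z) S & cancel S (shift_op T z)]].

Definition spectrum (T : {linear l2 R -> l2 R}) : set (C R) :=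
  ~` resolvent_set T.

Definition eigenvalues (T : {linear l2 R -> l2 R}) : set (C R) :=
  [set z | exists2 u, u != 0 & T u = z *: u].

(* The algebraic multiplicity of z is the dimension of this subspace. *)
Definition root_space (T : {linear l2 R -> l2 R}) z : set (l2 R) :=
  [set u | exists m, iter m (shift_op T z) u = 0].

Definition finite_dimensional (V : set (l2 R)) :=
  exists (d : nat) (e : 'I_d -> l2 R), forall u, V u ->
    exists c : 'I_d -> C R, u = \sum_(i < d) c i *: e i.

Definition discrete_spectrum (T : {linear l2 R -> l2 R}) : set (C R) :=
  [set z | [/\ isolated (spectrum T) z, eigenvalues T z &
    finite_dimensional (root_space T z)]].

Definition dist_segment z : R :=
  inf [set normc (z - x%:C) | x in `[(-2 : R), 2]].

Definition J (n : nat) (alpha : R) : {linear l2 R -> l2 R} :=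
  laplacian \+ (('i * (n%:R `^ (- alpha))%:C : C R) \*: proj n).

End Operators.
Arguments laplacian R : clear implicits.

(* A Lieb-Thirring type sum over the discrete spectrum, taken as a set: each
   eigenvalue contributes once, whatever its multiplicity. *)
Definition LT_ratio (R : realType) (alpha : R) (n : nat) : \bar R :=
  ((trace_norm (J n alpha \- laplacian R)%R)^-1 *
   (\esum_(z in discrete_spectrum (J n alpha))
     (dist_segment z / Num.sqrt (normc (z ^+ 2 - 4)))%:E)%R)%E.

(* Main.v *)
Require Import Defs.
From mathcomp Require Import all_boot all_order all_algebra.
From mathcomp Require Import all_classical all_reals all_analysis.
From mathcomp Require Import complex zify ring lra.
Set Implicit Arguments.
Unset Strict Implicit.
Unset Printing Implicit Defensive.
Import Order.TTheory GRing.Theory Num.Theory.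
Import numFieldNormedType.Exports.
Import ComplexField.Normc.
Local Open Scope classical_set_scope.
Local Open Scope ring_scope.
Local Open Scope complex_scope.

(** Write [h = n^-alpha], [T = J_0 + i h P_n], [z = w + 1/w] with [|w| < 1], and
    [nu + 1/nu = z - i h]. An eigenvector of [T] is a combination of [nu^k] and
    [nu^-k] on the first [n] sites and a multiple of [w^k] beyond, and matching
    the two at site [n] gives the characteristic equation
    [nu^(2n) = i h w / (nu - w)^2]. Take [nu] in the upper half-plane near
    [e^(i theta)] and [w] in the lower half-plane (it is then close to
    [1/nu]). The right-hand side has size between [1] and a power of [1/n], so a
    [2n]-th root of it is [e^(i theta_j)] up to a relative error
    [O(log n / n)], where [theta_j = 2 pi j / n]. For [theta_j] larger than a
    small negative power [tau] of [n], taking the [2n]-th root turns the equation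
    into a contraction in [log nu] near [i theta_j], and its fixed point is the
    resonance of [resonance_ex]. The arguments of these fixed points are within
    less than half the spacing of the [theta_j], so the eigenvalues are distinct.

    Such an eigenvalue [z] has [Im z >= h / 2], since [Im (nu + 1/nu)] is only
    [O(log n / n)], which is negligible against [h] because [alpha < 1]; and
    [|z^2 - 4|^(1/2)] is [O(theta_j)]. It therefore contributes at least a
    constant times [h / theta_j] to the sum, and summing over [tau <= theta_j <= 1/2]
    gives a harmonic sum: at least a constant times [n h log (1 / tau)], that is
    [n^(1 - alpha) log n]. Dividing by the trace norm [n h]
    ([trace_norm_potential]) leaves [log n].

    Membership in the discrete spectrum needs two more facts. Isolation:
    the free operator factors as [- (1 - w L) (1 - w L') / w] with [L], [L'] the
    shifts, so its resolvent is explicit and bounded, and the resolvent of the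
    finite-rank perturbation [T] exists unless a nonzero polynomial in [w]
    vanishes ([resolvent_of_jost], [jost_poly_neq0]); hence the spectrum in the
    upper half-plane is finite. Finite algebraic multiplicity: an infinite Jordan
    chain at [z] would sum up to eigenvectors at all points [z + e] with [e > 0]
    small, contradicting isolation ([jordan_chain_finite]). *)

Local Notation C R := (R[i]^o).

(** * The modulus and polar coordinates *)

Section Modulus.
Context {R : realType}.
Implicit Types (x y z : R[i]) (a b t : R).

Lemma normc_ge0 z : 0 <= normc z.
Proof. by case: z => a b; rewrite /= sqrtr_ge0. Qed.

Lemma sqr_normcE z : normc z ^+ 2 = complex.Re z ^+ 2 + complex.Im z ^+ 2.
Proof. by case: z => a b; rewrite /= sqr_sqrtr// addr_ge0// sqr_ge0. Qed.

Lemma normc_gt0 z : (0 < normc z) = (z != 0).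
Proof.
rewrite lt0r normc_ge0 andbT; congr (~~ _); apply/eqP/eqP; first exact: eq0_normc.
by move=> ->; exact: normc0.
Qed.

Lemma normcD_le x y : normc (x + y) <= normc x + normc y.
Proof. exact: (@le_normcD R x y). Qed.

Lemma normc_opp z : normc (- z) = normc z.
Proof. exact: (@normcN R z). Qed.

Lemma normc_distC x y : normc (x - y) = normc (y - x).
Proof. by rewrite -normc_opp opprB. Qed.

Lemma normcB_le x y : normc (x - y) <= normc x + normc y.
Proof. by rewrite -(normc_opp y) normcD_le. Qed.

Lemma normcB_ge x y : normc x - normc y <= normc (x - y).
Proof. by rewrite lerBlDr -{1}(subrK y x) normcD_le. Qed.

Lemma normcX z n : normc (z ^+ n) = normc z ^+ n.
Proof. by elim: n => [|n IH]; rewrite ?expr0 ?normc1 // !exprS normcM IH. Qed.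

Lemma normc_div x y : normc (x / y) = normc x / normc y.
Proof. by rewrite normcM normcV. Qed.

Lemma normc_real a : normc a%:C = `|a|.
Proof. by rewrite /= expr0n addr0 sqrtr_sqr. Qed.

Lemma normc_i : normc ('i : R[i]) = 1.
Proof. by rewrite /= expr0n add0r expr1n sqrtr1. Qed.

Lemma normc_nat n : normc (n%:R : R[i]) = n%:R.
Proof. by rewrite -(rmorph_nat (real_complex R)) normc_real ger0_norm. Qed.

Lemma normc_Re z : `|complex.Re z| <= normc z.
Proof.
by rewrite -(ler_pXn2r (n := 2)) ?nnegrE ?normc_ge0 //
  sqr_normcE real_normK ?num_real // lerDl sqr_ge0.
Qed.

Lemma normc_Im z : `|complex.Im z| <= normc z.
Proof.
by rewrite -(ler_pXn2r (n := 2)) ?nnegrE ?normc_ge0 //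
  sqr_normcE real_normK ?num_real // lerDr sqr_ge0.
Qed.

Lemma normc_ReIm z : normc z <= `|complex.Re z| + `|complex.Im z|.
Proof.
rewrite -(ler_pXn2r (n := 2)) ?nnegrE ?normc_ge0 ?addr_ge0 // sqr_normcE sqrrD.
by rewrite !real_normK ?num_real // lerD2r lerDl mulrn_wge0 // mulr_ge0.
Qed.

Lemma Re_add x y : complex.Re (x + y) = complex.Re x + complex.Re y.
Proof. by case: x; case: y. Qed.
Lemma Im_add x y : complex.Im (x + y) = complex.Im x + complex.Im y.
Proof. by case: x; case: y. Qed.
Lemma Re_opp x : complex.Re (- x) = - complex.Re x.
Proof. by case: x. Qed.
Lemma Im_opp x : complex.Im (- x) = - complex.Im x.
Proof. by case: x. Qed.
Lemma Re_mul x y : complex.Re (x * y) =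
  complex.Re x * complex.Re y - complex.Im x * complex.Im y.
Proof. by case: x; case: y. Qed.
Lemma Im_mul x y : complex.Im (x * y) =
  complex.Re x * complex.Im y + complex.Im x * complex.Re y.
Proof. by case: x; case: y. Qed.
Lemma Im_inv x : complex.Im x^-1 = - complex.Im x / normc x ^+ 2.
Proof. by rewrite sqr_normcE mulNr -mulNr; case: x => a b /=; rewrite mulNr. Qed.

Lemma eq_complexP x y : complex.Re x = complex.Re y -> complex.Im x = complex.Im y ->
  x = y.
Proof. by case: x => a b; case: y => c d /= -> ->. Qed.

Lemma ler_norm_sinx t : `|sin t| <= `|t|.
Proof.
wlog t0 : t / 0 <= t.
  move=> H; have [/H//|/ltW t0] := leP 0 t.
  by have := H (- t); rewrite oppr_ge0 sinN !normrN => /(_ t0).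
have [x1|z _] := @MVT_segment _ sin cos _ _ t0.
  exact/continuous_subspaceT/continuous_sin.
rewrite sin0 !subr0 => ->; rewrite normrM ler_piMl //; exact: cos_max.
Qed.

Lemma cos_ge_quadratic t : 1 - t ^+ 2 / 2 <= cos t.
Proof.
have -> : cos t = 1 - sin (t / 2) ^+ 2 *+ 2.
  rewrite {1}[t]splitr cosD -!expr2 cos2sin2 mulr2n; ring.
have := ler_norm_sinx (t / 2); set s := sin _ => h.
have : s ^+ 2 <= (t / 2) ^+ 2.
  by rewrite -(real_normK (num_real s)) -(real_normK (num_real (t/2)))
    ler_pXn2r ?nnegrE.
rewrite -[s ^+ 2 *+ 2]mulr_natr; set u := s ^+ 2; have -> : (t / 2) ^+ 2 = t ^+ 2 / 4 by field.
by move=> ?; lra.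
Qed.

(** [e^(a + i b)] *)
Definition cexp a b : R[i] := (expR a * cos b) +i* (expR a * sin b).

Lemma normc_cexp a b : normc (cexp a b) = expR a.
Proof.
apply/eqP; rewrite -(eqrXn2 (n := 2)) ?normc_ge0 ?expR_ge0 //.
by rewrite sqr_normcE /= !exprMn -mulrDr cos2Dsin2 mulr1.
Qed.

Lemma cexp_neq0 a b : cexp a b != 0.
Proof. by rewrite -normc_gt0 normc_cexp expR_gt0. Qed.

Lemma cexpD a b a' b' : cexp (a + a') (b + b') = cexp a b * cexp a' b'.
Proof. by apply: eq_complexP; rewrite ?Re_mul ?Im_mul /= expRD ?cosD ?sinD; ring. Qed.

Lemma cexp0 : cexp 0 0 = 1.
Proof. by apply: eq_complexP; rewrite /= expR0 ?cos0 ?sin0 !mul1r. Qed.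

Lemma cexpX a b n : cexp a b ^+ n = cexp (n%:R * a) (n%:R * b).
Proof.
elim: n => [|n IH]; first by rewrite !mul0r cexp0.
by rewrite exprS IH -cexpD !mulr_natl -!mulrS.
Qed.

Lemma expR_sub1_le t : `|t| <= 1 / 2 -> `|expR t - 1| <= 2 * `|t|.
Proof.
move=> t1.
have h1 := expR_ge1Dx t; have h2 := expR_ge1Dx (- t).
have := expRxMexpNx_1 t; have := expR_gt0 t.
move: h1 h2; set e := expR t; set e' := expR (- t) => h1 h2 e0 ee.
have [t0|t0] := leP 0 t.
  rewrite (ger0_norm t0) in t1 *.
  rewrite ger0_norm; last lra.
  have h3 : e * (1 - t) <= e * e' by rewrite ler_pM2l.
  rewrite ee in h3.
  nra.
rewrite (ltr0_norm t0) in t1 *.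
have : e < 1 by rewrite expR_lt1.
by move=> ?; rewrite ltr0_norm; lra.
Qed.

Lemma normc_cexp_sub1_le a b : `|a| <= 1 / 2 ->
  normc (cexp a b - 1) <= 2 * (`|a| + `|b|).
Proof.
move=> a1.
have -> : cexp a b - 1 = (expR a - 1)%:C + (expR a)%:C * (cexp 0 b - 1).
  by apply: eq_complexP; rewrite /= expR0; ring.
have e2 : expR a <= 2.
  by have := expR_sub1_le a1 => /(le_trans (ler_norm _)); lra.
apply: (le_trans (normcD_le _ _)); rewrite normcM !normc_real.
rewrite mulrDr lerD ?expR_sub1_le // ler_pM ?normc_ge0 //.
  by rewrite ger0_norm ?expR_ge0.
rewrite -(ler_pXn2r (n := 2)) ?nnegrE ?normc_ge0 // sqr_normcE /= expR0 !mul1r.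
rewrite subr0 real_normK ?num_real //.
by have := cos2Dsin2 b; have := cos_ge_quadratic b; set c := cos b; nra.
Qed.

Lemma normc_cexp_dist a b a' b' : `|a - a'| <= 1 / 2 ->
  normc (cexp a b - cexp a' b') <= expR a' * (2 * (`|a - a'| + `|b - b'|)).
Proof.
move=> aa.
have -> : cexp a b - cexp a' b' = cexp a' b' * (cexp (a - a') (b - b') - 1).
  by rewrite mulrBr -cexpD mulr1 !subrKC.
by rewrite normcM normc_cexp ler_pM2l ?expR_gt0 // normc_cexp_sub1_le.
Qed.

Lemma ln_norm_le a : 1 / 2 <= a -> `|ln a| <= 2 * `|a - 1|.
Proof.
move=> a2; have a0 : 0 < a by lra.
have [a1|a1] := leP 1 a.
  rewrite !ger0_norm ?subr_ge0 ?ln_ge0 //.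
  by have := @le_ln1Dx R (a - 1); rewrite subrKC; lra.
rewrite !ler0_norm ?subr_le0 ?ln_le0 ?(ltW a1) // -lnV ?posrE //.
have := @le_ln1Dx R (a^-1 - 1); rewrite subrKC.
have : 0 < a^-1 by rewrite invr_gt0.
have : a * a^-1 = 1 by rewrite mulfV ?gt_eqF.
set v := a^-1 => av v0 h. apply: (le_trans (h _)); first lra.
nra.
Qed.

Lemma atan_norm_le t : `|atan t| <= `|t|.
Proof.
wlog t0 : t / 0 <= t.
  move=> H; have [/H//|/ltW t0] := leP 0 t.
  by have := H (- t); rewrite oppr_ge0 atanN !normrN => /(_ t0).
have [x1|z _] := @MVT_segment _ atan (fun a => (1 + a ^+ 2)^-1) _ _ t0.
  by apply: continuous_subspaceT => x; exact: continuous_atan.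
rewrite atan0 !subr0 => ->; rewrite normrM ler_piMl // ger0_norm.
  by rewrite invf_le1 ?ltr_pwDl ?sqr_ge0 // lerDl sqr_ge0.
by rewrite invr_ge0 addr_ge0 ?sqr_ge0.
Qed.

Lemma clog_ex z : z != 0 ->
  exists2 b, `|b| <= pi & z = cexp (ln (normc z)) b.
Proof.
move=> z0; have r0 : 0 < normc z by rewrite normc_gt0.
set r := normc z in r0 *; set c := complex.Re z / r; set s := complex.Im z / r.
have cs : c ^+ 2 + s ^+ 2 = 1.
  by rewrite !expr_div_n -mulrDl -sqr_normcE divff ?expf_neq0 // gt_eqF.
have c1 : -1 <= c <= 1.
  by have := sqr_ge0 s; apply: contraTT; rewrite negb_and -!ltNge => /orP[]?; nra.
have zE : forall b, cos b = c -> sin b = s -> z = cexp (ln r) b.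
  move=> b cb sb; rewrite /cexp lnK ?posrE // cb sb.
  by apply: eq_complexP; rewrite /= mulrC divfK ?gt_eqF.
have [p0 p1] := (acos_ge0 c1, acos_lepi c1).
have ss : sin (acos c) = `|s| by rewrite sin_acos // -sqrtr_sqr -cs addrAC subrr add0r.
have [s0|s0] := leP 0 s.
  exists (acos c); rewrite ?ger0_norm //; apply: zE; first by rewrite acosK.
  by rewrite ss ger0_norm.
exists (- acos c); rewrite ?normrN ?ger0_norm //; apply: zE.
  by rewrite cosN acosK.
by rewrite sinN ss ltr0_norm ?opprK.
Qed.

(** Near [1] the argument of [z] is [atan (Im z / Re z)], which is Lipschitz
    in [z]. *)
Lemma clog_near1 z : normc (z - 1) <= 1 / 2 ->
  exists a b, z = cexp a b /\ `|a| + `|b| <= 4 * normc (z - 1).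
Proof.
move=> z1; have re := le_trans (normc_Re _) z1; have im := normc_Im (z - 1).
have r1 : `|normc z - 1| <= normc (z - 1).
  rewrite ler_norml; apply/andP; split.
    by rewrite lerNl opprB -{1}(normc1 R) normc_distC normcB_ge.
  by rewrite -{1}(normc1 R) normcB_ge.
have rz : 1 / 2 <= normc z by move: r1; rewrite ler_norml; lra.
have x0 : 1 / 2 <= complex.Re z.
  by move: re; rewrite Re_add Re_opp /= ler_norml; lra.
rewrite Im_add Im_opp /= oppr0 addr0 in im.
set x := complex.Re z in x0; set y := complex.Im z in im.
exists (ln (normc z)), (atan (y / x)); split.
  have x00 : 0 < x by lra.
  have r : Num.sqrt (1 + (y / x) ^+ 2) = normc z / x.
    apply/eqP; rewrite -(eqrXn2 (n := 2)) ?sqrtr_ge0 ?divr_ge0 ?normc_ge0 ?(ltW x00) //.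
    rewrite sqr_sqrtr ?addr_ge0 ?sqr_ge0 // !expr_div_n sqr_normcE -/x -/y.
    apply/eqP; field.
    by rewrite gt_eqF.
  have c : cos (atan (y / x)) = x / normc z by rewrite cos_atan r invf_div.
  have s : sin (atan (y / x)) = y / normc z.
    have /eqP := atanK (y / x); rewrite /tan c.
    have zz : normc z != 0 by rewrite gt_eqF //; lra.
    have xz : x / normc z != 0 by rewrite mulf_neq0 ?invr_eq0 // gt_eqF.
    rewrite eqr_div ?(lt0r_neq0 x00) //.
    move=> /eqP h; apply: (mulIf (lt0r_neq0 x00)); rewrite h; field.
    by rewrite zz.
  rewrite /cexp c s. rewrite lnK ?posrE; last lra.
  by apply: eq_complexP; rewrite /= mulrC divfK // gt_eqF //; lra.
have -> : 4 * normc (z - 1) = 2 * normc (z - 1) + 2 * normc (z - 1) by ring.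
apply: lerD.
  by apply: (le_trans (ln_norm_le rz)); rewrite ler_pM2l.
have x00 : 0 < x by lra.
apply: (le_trans (atan_norm_le _)); rewrite normrM normfV mulrC.
rewrite (gtr0_norm x00) ler_pM ?invr_ge0 ?(ltW x00) //.
by rewrite -[leRHS]invrK lef_pV2 ?posrE ?invr_gt0 //; lra.
Qed.

End Modulus.

(** * The characteristic equation *)

Section Joukowski.
Context {R : realType}.
Implicit Types (z w nu : R[i]) (h tau : R).

Lemma joukowski_inv z : 0 < complex.Im z ->
  exists w, [/\ w != 0, normc w < 1, complex.Im w < 0 & w + w^-1 = z].
Proof.
move=> z0.
have [s s2] : exists s : R[i], s ^+ 2 = z ^+ 2 - 4.
  by exists (complex.sqrtc (z ^+ 2 - 4)); rewrite sqr_sqrtc.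
have [w w0 wz] : exists2 w, w != 0 & w + w^-1 = z.
  have e : (z + s) / 2 * ((z - s) / 2) = 1.
    have -> : (z + s) / 2 * ((z - s) / 2) = (z ^+ 2 - s ^+ 2) / 4 by field.
    by rewrite s2; field.
  have w0 : (z + s) / 2 != 0.
    by apply/eqP => e0; move: e; rewrite e0 mul0r => /esym/eqP; rewrite oner_eq0.
  exists ((z + s) / 2) => //.
  have -> : ((z + s) / 2)^-1 = (z - s) / 2 by apply: (mulfI w0); rewrite e mulfV.
  by field.
have im v : v != 0 -> v + v^-1 = z ->
    complex.Im v * (normc v ^+ 2 - 1) = complex.Im z * normc v ^+ 2.
  move=> v0 <-; rewrite Im_add Im_inv; field.
  by rewrite gt_eqF // normc_gt0.
have done_ v : v != 0 -> v + v^-1 = z -> normc v < 1 -> complex.Im v < 0.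
  move=> v0 vz v1; have := im v v0 vz.
  have n0 : 0 < normc v by rewrite normc_gt0.
  have : 0 < complex.Im z * normc v ^+ 2 by rewrite mulr_gt0 // exprn_gt0.
  have : normc v ^+ 2 - 1 < 0 by rewrite subr_lt0 expr_lt1 // normc_ge0.
  set q := normc v ^+ 2 - 1; set p := _ * _ ^+ 2 => q0 p0 e; nra.
have n0 : 0 < normc w by rewrite normc_gt0.
have [w1|w1|w1] := ltrgtP (normc w) 1; first by exists w; split=> //; exact: done_.
  have v0 : w^-1 != 0 by rewrite invr_eq0.
  have vz : w^-1 + w^-1^-1 = z by rewrite invrK addrC.
  have v1 : normc w^-1 < 1 by rewrite normcV invf_lt1.
  by exists w^-1; split=> //; exact: done_.
have := im w w0 wz; rewrite w1 expr1n subrr mulr0 mulr1 => e.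
by move: z0; rewrite -e ltxx.
Qed.

(** [w] and [nu] parametrise the same spectral parameter: [w] is the decay rate
    of the eigenvector outside the support of the potential, [nu] and its
    inverse are its growth rates inside. *)
Definition dispersion h nu w :=
  [/\ w != 0, normc w < 1, complex.Im w < 0 & w + w^-1 = nu + nu^-1 + 'i * h%:C].

(** The value that [nu^(2n)] takes at an eigenvalue. By [dispersion_factor] it is
    [(nu^-1 - w) / (nu - w)]; the present form shows that it is of the size of
    [h], up to powers of [|nu - w|]. *)
Definition reflection h nu w : R[i] := 'i * h%:C * w / (nu - w) ^+ 2.

Lemma dispersion_factor h nu w : nu != 0 -> dispersion h nu w ->
  (nu - w) * (nu^-1 - w) = 'i * h%:C * w.
Proof.
move=> nu0 [w0 _ _ e].
have -> : 'i * h%:C * w = (w + w^-1 - (nu + nu^-1)) * w by rewrite e; ring.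
by field; rewrite nu0.
Qed.

(** Since [nu] and [w] lie on opposite sides of the real axis, they are at
    distance at least [Im nu]; then [w] is forced to be close to [nu^-1]. *)
Lemma dispersion_gap h tau nu w : 0 < h -> h <= tau ^+ 2 / 4 ->
    0 < tau -> tau <= complex.Im nu -> normc nu ^+ 2 <= 2 ->
  dispersion h nu w -> tau <= normc (nu - w) /\ complex.Im w <= - (tau / 4).
Proof.
move=> h0 ht t0 nut nu2 d; have [w0 w1 wi _] := d.
have gap : tau <= normc (nu - w).
  apply: (le_trans _ (normc_Im _)); rewrite Im_add Im_opp ler_normr; apply/orP; left.
  lra.
split=> //.
have nu0 : nu != 0 by apply: contraTneq nut => ->; rewrite -ltNge.
have n0 : 0 < normc nu by rewrite normc_gt0.
have iV : complex.Im nu^-1 <= - (tau / 2).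
  rewrite Im_inv mulNr lerN2 ler_pdivlMr ?exprn_gt0 //.
  by move: nu2; set q := normc nu ^+ 2 => nu2; nra.
have close : normc (nu^-1 - w) <= tau / 4.
  have := congr1 (@normc R) (dispersion_factor nu0 d).
  rewrite !normcM normc_i normc_real mul1r gtr0_norm // => e.
  have : normc (nu - w) * normc (nu^-1 - w) <= h.
    by rewrite e -[leRHS]mulr1 ler_pM2l // ltW.
  have := normc_ge0 (nu^-1 - w); set y := normc (nu^-1 - w) => y0.
  move: gap; set g := normc (nu - w) => gap gy.
  have : tau * y <= tau * (tau / 4).
    apply: (@le_trans _ _ (g * y)); first by rewrite ler_wpM2r.
    by apply: (le_trans gy); apply: (le_trans ht); rewrite expr2 mulrA.
  by rewrite ler_pM2l.
have := le_trans (normc_Im _) close; rewrite Im_add Im_opp ler_norml => /andP[+ _].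
lra.
Qed.

(** Differences of [x + x^-1] factor as [(x - y) (1 - (x y)^-1)], and for two
    points [w] of the lower half-plane the second factor is bounded below. *)
Lemma dispersion_lipschitz h tau nu1 w1 nu2 w2 :
    0 < h -> h <= tau ^+ 2 / 4 -> 0 < tau ->
    tau <= complex.Im nu1 -> normc nu1 ^+ 2 <= 2 -> 1 / 2 <= normc nu1 ->
    tau <= complex.Im nu2 -> normc nu2 ^+ 2 <= 2 -> 1 / 2 <= normc nu2 ->
    dispersion h nu1 w1 -> dispersion h nu2 w2 ->
  normc (w1 - w2) <= 20 / tau * normc (nu1 - nu2).
Proof.
move=> h0 ht t0 i1 n1 m1 i2 n2 m2 d1 d2.
have [_ u1] := dispersion_gap h0 ht t0 i1 n1 d1.
have [w10 w1l w1i e1] := d1; have [w20 w2l w2i e2] := d2.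
have p1 : 0 < normc nu1 by lra.
have p2 : 0 < normc nu2 by lra.
have z1 : nu1 != 0 by rewrite -normc_gt0.
have z2 : nu2 != 0 by rewrite -normc_gt0.
have e : (w1 - w2) * (1 - (w1 * w2)^-1) = (nu1 - nu2) * (1 - (nu1 * nu2)^-1).
  transitivity ((w1 + w1^-1) - (w2 + w2^-1)); first by field; rewrite w10 w20.
  by rewrite e1 e2; field; rewrite z1 z2.
have low : tau / 4 <= normc (1 - (w1 * w2)^-1).
  have a : normc (w1 - w2^-1) <= normc (1 - (w1 * w2)^-1).
    have -> : w1 - w2^-1 = w1 * (1 - (w1 * w2)^-1) by field; rewrite w10 w20.
    by rewrite normcM ler_piMl ?normc_ge0 // ltW.
  apply: le_trans a; apply: le_trans (normc_Im _); rewrite Im_add Im_opp ler_normr.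
  apply/orP; right; rewrite Im_inv mulNr opprK opprD.
  have : complex.Im w2 / normc w2 ^+ 2 < 0.
    by rewrite pmulr_llt0 // invr_gt0 exprn_gt0 // normc_gt0.
  lra.
have up : normc (1 - (nu1 * nu2)^-1) <= 5.
  apply: (le_trans (normcB_le _ _)); rewrite normc1 normcV normcM.
  have : (normc nu1 * normc nu2)^-1 <= (1 / 4)^-1.
    by rewrite lef_pV2 ?posrE ?mulr_gt0 //; nra.
  by rewrite invf_div; lra.
have := congr1 (@normc R) e; rewrite !normcM.
move: (normc_ge0 (w1 - w2)) (normc_ge0 (nu1 - nu2)) low up.
set x := normc (w1 - w2); set y := normc (nu1 - nu2).
set p := normc (1 - _); set q := normc (1 - _) => x0 y0 low up eq.
rewrite mulrAC ler_pdivlMr //; nra.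
Qed.

(** A crude power of [tau] suffices: [tau] will be a small negative power of [n],
    while the [2n]-th root gains a factor [1 / n]. *)
Lemma reflection_lipschitz h tau nu1 w1 nu2 w2 :
    0 < h -> h <= tau ^+ 2 / 4 -> 0 < tau -> tau <= 1 ->
    tau <= complex.Im nu1 -> normc nu1 ^+ 2 <= 2 -> 1 / 2 <= normc nu1 ->
    tau <= complex.Im nu2 -> normc nu2 ^+ 2 <= 2 -> 1 / 2 <= normc nu2 ->
    dispersion h nu1 w1 -> dispersion h nu2 w2 ->
  normc (reflection h nu1 w1 / reflection h nu2 w2 - 1)
    <= (6 / tau) ^+ 4 * normc (nu1 - nu2).
Proof.
move=> h0 ht t0 t1 i1 n1 m1 i2 n2 m2 d1 d2.
have lip := dispersion_lipschitz h0 ht t0 i1 n1 m1 i2 n2 m2 d1 d2.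
have [g1 u1] := dispersion_gap h0 ht t0 i1 n1 d1.
have [g2 u2] := dispersion_gap h0 ht t0 i2 n2 d2.
have [w10 w1l _ _] := d1; have [w20 w2l _ _] := d2.
have up nu w : normc nu ^+ 2 <= 2 -> normc w < 1 -> normc (nu - w) <= 3.
  move=> n w1_; apply: (le_trans (normcB_le _ _)).
  have : normc nu <= 2 by rewrite -(ler_pXn2r (n := 2)) ?nnegrE ?normc_ge0 //; lra.
  lra.
have {up}[r1 r2] := (up _ _ n1 w1l, up _ _ n2 w2l).
move: lip g1 g2 r1 r2; rewrite /reflection.
have tri : normc ((nu2 - w2) - (nu1 - w1)) <= normc (nu1 - nu2) + normc (w1 - w2).
  have -> : nu2 - w2 - (nu1 - w1) = (w1 - w2) - (nu1 - nu2) by ring.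
  by rewrite [leRHS]addrC; exact: normcB_le.
move: tri; set D1 := nu1 - w1; set D2 := nu2 - w2 => tri lip g1 g2 r1 r2.
have D10 : D1 != 0 by rewrite -normc_gt0 (lt_le_trans t0).
have D20 : D2 != 0 by rewrite -normc_gt0 (lt_le_trans t0).
have h0' : h%:C != 0 by rewrite -normc_gt0 normc_real gtr0_norm.
have i0 : ('i : R[i]) != 0 by rewrite -normc_gt0 normc_i.
have -> : 'i * h%:C * w1 / D1 ^+ 2 / ('i * h%:C * w2 / D2 ^+ 2) - 1 =
    ((w1 - w2) * D2 ^+ 2 + w2 * ((D2 - D1) * (D2 + D1))) / (w2 * D1 ^+ 2).
  by field; rewrite D10 D20 w20 h0' i0.
rewrite normc_div.
have den : tau ^+ 3 / 4 <= normc (w2 * D1 ^+ 2).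
  rewrite normcM normcX.
  have a : tau / 4 <= normc w2.
    apply: le_trans (normc_Im _); rewrite ler_normr; apply/orP; right; lra.
  have -> : tau ^+ 3 / 4 = tau / 4 * tau ^+ 2 by field.
  rewrite ler_pM ?exprn_ge0 ?(ltW t0) ?divr_ge0 // ?(ltW t0) //.
  by rewrite ler_pXn2r ?nnegrE ?normc_ge0 ?(ltW t0).
have num : normc ((w1 - w2) * D2 ^+ 2 + w2 * ((D2 - D1) * (D2 + D1)))
    <= 324 / tau * normc (nu1 - nu2).
  apply: (le_trans (normcD_le _ _)); rewrite !normcM -[normc D2 * normc D2]expr2.
  have s := normcD_le D2 D1.
  have : normc (w1 - w2) * normc D2 ^+ 2 <= 9 * normc (w1 - w2).
    rewrite mulrC ler_wpM2r ?normc_ge0 //.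
    have -> : 9 = 3 ^+ 2 :> R by rewrite -natrX.
    by rewrite ler_pXn2r ?nnegrE ?normc_ge0.
  have : normc w2 * (normc (D2 - D1) * normc (D2 + D1))
      <= 6 * (normc (nu1 - nu2) + normc (w1 - w2)).
    apply: (@le_trans _ _ (normc (D2 - D1) * normc (D2 + D1))).
      by rewrite ler_piMl ?mulr_ge0 ?normc_ge0 // ltW.
    by rewrite [leRHS]mulrC ler_pM ?normc_ge0 //; lra.
  have : normc (nu1 - nu2) <= 1 / tau * normc (nu1 - nu2).
    by rewrite ler_peMl ?normc_ge0 // ler_pdivlMr // mul1r.
  move: lip (normc_ge0 (nu1 - nu2)); set X := normc (w1 - w2); set Y := normc (nu1 - nu2).
  have -> : 20 / tau * Y = 20 * (1 / tau * Y) by field; rewrite gt_eqF.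
  have -> : 324 / tau * Y = 324 * (1 / tau * Y) by field; rewrite gt_eqF.
  lra.
have dp : 0 < tau ^+ 3 / 4 by rewrite divr_gt0 ?exprn_gt0.
rewrite ler_pdivrMr ?(lt_le_trans dp) //; apply: (le_trans num).
have -> : 324 / tau * normc (nu1 - nu2) =
   (6 / tau) ^+ 4 * normc (nu1 - nu2) * (tau ^+ 3 / 4) by field; rewrite gt_eqF.
apply: ler_wpM2l den; apply: mulr_ge0 (normc_ge0 _).
by rewrite exprn_ge0 // divr_ge0 // ltW.
Qed.

End Joukowski.

(** * Solving the characteristic equation *)

Section GeometricSequences.
Context {R : realType}.
Implicit Types (u : nat -> R) (M : R).

Lemma cvg_div_pow2 M : (fun k => M / 2 ^+ k) @ \oo --> (0 : R).
Proof.
have l : `|1 / 2| < 1 :> R by rewrite ger0_norm ?divr_ge0 //; lra.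
have := cvg_geometric M l.
apply: cvg_trans; apply: near_eq_cvg; apply: nearW => k.
by rewrite /geometric /= expr_div_n expr1n mul1r.
Qed.

Lemma geometric_small M (X : R) k0 :
  (forall k, (k0 <= k)%N -> X <= M / 2 ^+ k) -> X <= 0.
Proof.
move=> H.
have c := cvg_div_pow2 M.
rewrite -(cvg_lim _ c) //; apply: limr_ge; first by apply: cvgP c.
by exists k0 => // k; exact: H.
Qed.

Lemma geometric_cauchy u M : (forall k, `|u k.+1 - u k| <= M / 2 ^+ k) ->
  exists l, forall k, `|u k - l| <= 2 * M / 2 ^+ k.
Proof.
move=> H.
have tele k m : `|u (k + m)%N - u k| <= 2 * M / 2 ^+ k - 2 * M / 2 ^+ (k + m).
  elim: m => [|m IH]; first by rewrite addn0 !subrr normr0.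
  rewrite addnS; have := H (k + m)%N => Hm.
  have -> : u (k + m).+1 - u k = (u (k + m).+1 - u (k + m)%N) + (u (k + m)%N - u k).
    by rewrite addrA subrK.
  apply: (le_trans (ler_normD _ _)).
  have : 2 * M / 2 ^+ (k + m).+1 = M / 2 ^+ (k + m).
    by rewrite exprS; field; rewrite expf_neq0 // pnatr_eq0.
  lra.
have M0 : 0 <= M by have := H 0%N; rewrite expr0 divr1; exact: le_trans.
have tele' k m : `|u (k + m)%N - u k| <= 2 * M / 2 ^+ k.
  by apply: (le_trans (tele k m)); rewrite gerBl divr_ge0 ?mulr_ge0 ?exprn_ge0.
have cu : cvgn u.
  have -> : u = (fun k => u 0%N + series (fun j => u j.+1 - u j) k).
    by apply/funext => k; rewrite /series /= telescope_sumr // subrKC.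
  apply: is_cvgD; first exact: is_cvg_cst.
  apply: normed_cvg; apply: (@series_le_cvg _ _ (geometric M (1 / 2))) => //.
  - by move=> k; exact: normr_ge0.
  - by move=> k; rewrite /geometric /= mulr_ge0 // exprn_ge0.
  - by move=> k; rewrite /geometric /= expr_div_n expr1n mul1r; exact: H.
  - by apply: is_cvg_geometric_series; rewrite ger0_norm ?divr_ge0 //; lra.
exists (limn u) => k; rewrite distrC.
have c : (fun m => `|u m - u k|) @ \oo --> `|limn u - u k|.
  by apply: cvg_norm; apply: cvgB => //; exact: cvg_cst.
rewrite -(cvg_lim _ c) //; apply: limr_le; first by apply: cvgP c.
by exists k => // m /= km; rewrite -(subnKC km); exact: tele'.
Qed.

End GeometricSequences.

Section Resonance.
Context {R : realType}.
Variables (n : nat) (h tau rho theta : R).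
Hypothesis n0 : (0 < n)%N.
Hypothesis h0 : 0 < h.
Hypothesis htau : h <= tau ^+ 2 / 4.
Hypothesis tau0 : 0 < tau.
Hypothesis tau1 : tau <= 1 / 16.
Hypothesis theta_ge : 4 * tau <= theta.
Hypothesis theta_le : theta <= 1 / 2.
Hypothesis rho_h : rho <= h / 16.
Implicit Types (a b : R).

Local Ltac localize_hypotheses :=
  move: (h0) (htau) (tau0) (tau1) (theta_ge) (theta_le) (rho_h) => ? ? ? ? ? ? ?.

Let rho_tau : rho <= tau / 256.
Proof.
localize_hypotheses.
have t2 : tau * tau <= tau * (1 / 16) by rewrite ler_pM2l.
have h2 : h <= tau * tau / 4 by rewrite -expr2.
lra.
Qed.

(** The iteration takes place in a neighbourhood of [i theta] in the logarithm
    [a + i b] of [nu]. *)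
Definition in_box a b := `|a| + `|b - theta| <= rho.

Lemma sin_ge_half b : 0 <= b -> b <= 1 -> b / 2 <= sin b.
Proof.
move=> b0 b1.
have [x1|z] := @MVT_segment _ sin cos _ _ b0.
  exact/continuous_subspaceT/continuous_sin.
rewrite in_itv /= => /andP[z0 zb]; rewrite sin0 !subr0 => ->.
have := cos_ge_quadratic z; nra.
Qed.

(** In the box [nu] stays in the upper half-plane, and the correction
    [Im (nu + nu^-1) = O(rho)] cannot cancel the gain [h] of the potential. *)
Lemma box_bounds a b : in_box a b ->
  [/\ tau <= complex.Im (cexp a b), normc (cexp a b) ^+ 2 <= 2,
      1 / 2 <= normc (cexp a b) &
      h / 2 <= complex.Im (cexp a b + (cexp a b)^-1 + 'i * h%:C)].
Proof.
localize_hypotheses; have rt := rho_tau.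
rewrite /in_box => box; have p := normr_ge0 a; have q := normr_ge0 (b - theta).
have a1 : `|a| <= 1 / 2 by lra.
have := expR_sub1_le a1; have := @expR_sub1_le R (- a); rewrite normrN.
move=> /(_ a1); rewrite !ler_norml => /andP[e1 e2] /andP[e3 e4].
have tb : `|b - theta| <= rho by lra.
move: tb; rewrite ler_norml => /andP[b1 b2].
have sb : b / 2 <= sin b by apply: sin_ge_half; lra.
have sb1 := sin_le1 b.
have -> : (cexp a b)^-1 = cexp (- a) (- b).
  by apply: (mulfI (cexp_neq0 a b)); rewrite mulfV ?cexp_neq0 // -cexpD !subrr cexp0.
rewrite normc_cexp !Im_add Im_mul /= sinN mul0r mul1r add0r.
set e := expR a in e3 e4 *; set e' := expR (- a) in e1 e2 *.
set s := sin b in sb sb1 *; split; [nra|nra|lra|].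
have : 0 <= s by lra.
have : - (h / 4) <= e - e' by lra.
nra.
Qed.

Definition decay a b : R[i] := xget 0 [set w | dispersion h (cexp a b) w].

Lemma decayP a b : in_box a b -> dispersion h (cexp a b) (decay a b).
Proof.
localize_hypotheses; have rt := rho_tau.
case/box_bounds => _ _ _ zi.
have z0 : 0 < complex.Im (cexp a b + (cexp a b)^-1 + 'i * h%:C) by lra.
have [w [w0 w1 wi wz]] := joukowski_inv z0.
by apply: (@xgetPex _ 0 [set w | dispersion h (cexp a b) w]); exists w.
Qed.

Definition refl a b : R[i] := reflection h (cexp a b) (decay a b).

Lemma refl_norm a b : in_box a b ->
  h * tau / 36 <= normc (refl a b) /\ normc (refl a b) <= 1.
Proof.
localize_hypotheses; have rt := rho_tau.
move=> box; have [i1 m1 m2 _] := box_bounds box; have d := decayP box.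
have [g u] := dispersion_gap h0 htau tau0 i1 m1 d.
have [w0 w1 wi _] := d.
rewrite /refl /reflection normc_div !normcM normc_i normc_real mul1r.
rewrite (gtr0_norm h0).
rewrite -[normc (_ - _) * _]expr2.
have wt : tau / 4 <= normc (decay a b).
  apply: le_trans (normc_Im _); rewrite ler_normr; apply/orP; right; lra.
have m3 : normc (cexp a b) <= 2.
  by rewrite -(ler_pXn2r (n := 2)) ?nnegrE ?normc_ge0 //; lra.
have g3 : normc (cexp a b - decay a b) <= 3.
  by apply: (le_trans (normcB_le _ _)); lra.
move: wt w1 g g3; set x := normc (decay a b); set d' := normc (_ - _).
move=> wt w1 g g3; have d2 : 0 < d' ^+ 2 by rewrite exprn_gt0 //; lra.
rewrite ler_pdivlMr // ler_pdivrMr // mul1r; split; last first.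
  have : tau ^+ 2 <= d' ^+ 2 by rewrite ler_pXn2r ?nnegrE //; lra.
  nra.
have d9 : d' ^+ 2 <= 9.
  by have -> : 9 = 3 ^+ 2 :> R by [rewrite -natrX]; rewrite ler_pXn2r ?nnegrE //; lra.
apply: (@le_trans _ _ (h * tau / 36 * 9)).
  by rewrite ler_wpM2l // divr_ge0 // mulr_ge0 // ltW.
have -> : h * tau / 36 * 9 = h * (tau / 4) by field.
by rewrite ler_wpM2l // ltW.
Qed.

Lemma refl_neq0 a b : in_box a b -> refl a b != 0.
Proof.
move=> /refl_norm[+ _]; rewrite -normc_gt0; apply: lt_le_trans.
by rewrite divr_gt0 // mulr_gt0.
Qed.

Let kappa := 4 * (6 / tau) ^+ 4.

Lemma refl_lipschitz a b a' b' : in_box a b -> in_box a' b' ->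
  normc (refl a b / refl a' b' - 1) <= kappa * (`|a - a'| + `|b - b'|).
Proof.
localize_hypotheses; have rt := rho_tau.
move=> x x'; have [i1 m1 l1 _] := box_bounds x; have [i2 m2 l2 _] := box_bounds x'.
have tau1' : tau <= 1 by lra.
apply: (le_trans (reflection_lipschitz h0 htau tau0 tau1' i1 m1 l1 i2 m2 l2
  (decayP x) (decayP x'))).
have k0 : 0 <= (6 / tau) ^+ 4 by rewrite exprn_ge0 // divr_ge0 // ltW.
rewrite /kappa [4 * _]mulrC -[leRHS]mulrA; apply: (ler_wpM2l k0).
have aa : `|a - a'| <= 1 / 2.
  move: x x'; rewrite /in_box; have := ler_normB a a'.
  have := normr_ge0 (b - theta); have := normr_ge0 (b' - theta); lra.
apply: (le_trans (normc_cexp_dist _ _ aa)).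
have : expR a' <= 2.
  move: m2; rewrite normc_cexp => e2.
  by rewrite -(ler_pXn2r (n := 2)) ?nnegrE ?expR_ge0 //; lra.
have := normr_ge0 (a - a'); have := normr_ge0 (b - b').
set s := `|_| => s0; set t := `|_| => t0; nra.
Qed.

Hypothesis rho_tau4 : rho <= (tau / 12) ^+ 4.
Hypothesis rho_ln : ln (36 / (h * tau)) + pi <= n%:R * rho.
Hypothesis theta_period : cexp 0 ((2 * n)%:R * theta) = 1.

Let clog z : R * R :=
  xget (0, 0) [set p | z = cexp p.1 p.2 /\ `|p.1| + `|p.2| <= 4 * normc (z - 1)].

Let clogP z : normc (z - 1) <= 1 / 2 ->
  z = cexp (clog z).1 (clog z).2 /\
  `|(clog z).1| + `|(clog z).2| <= 4 * normc (z - 1).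
Proof.
move=> z1; have [a [b [e l]]] := clog_near1 z1.
apply: (@xgetPex _ (0, 0)
  [set p : R * R | z = cexp p.1 p.2 /\ `|p.1| + `|p.2| <= 4 * normc (z - 1)]).
by exists (a, b).
Qed.

Let dist (p p' : R * R) := `|p.1 - p'.1| + `|p.2 - p'.2|.

Let dist_triangle p q r : dist p r <= dist p q + dist q r.
Proof.
rewrite /dist addrACA lerD //; last by rewrite -{1}(subrK q.2 p.2) -addrA ler_normD.
by rewrite -{1}(subrK q.1 p.1) -addrA ler_normD.
Qed.

Let distC p q : dist p q = dist q p.
Proof. by rewrite /dist distrC (distrC p.2). Qed.

Let Rfl p := refl p.1 p.2.

Let N2 : R := (2 * n)%:R.

Let N2_gt0 : 0 < N2. Proof. by rewrite ltr0n muln_gt0. Qed.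

Let normN2V : `|N2^-1| = N2^-1.
Proof. by rewrite ger0_norm // invr_ge0 ltW. Qed.

Let zeta0 : R * R := (0, theta).

(** One step of the iteration solves [nu_(k+1)^(2n) = G(nu_k)], choosing a
    [2n]-th root of the ratio close to [1]. *)
Let step (p q : R * R) : R * R :=
  (q.1 + (clog (Rfl q / Rfl p)).1 / N2, q.2 + (clog (Rfl q / Rfl p)).2 / N2).

Let htau_le : h * tau <= 36.
Proof.
localize_hypotheses; have t2 : tau ^+ 2 <= 1 by rewrite expr_le1 //; lra.
by apply: (@le_trans _ _ (1 * 1)); [rewrite ler_pM ?(ltW h0) ?(ltW tau0) //; lra|lra].
Qed.

Let rho_gt0 : 0 < rho.
Proof.
localize_hypotheses.
have : 0 < n%:R * rho.
  apply: (lt_le_trans _ rho_ln); rewrite ltr_wpDl ?pi_gt0 // ln_ge0 //.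
  by rewrite ler_pdivlMr ?mulr_gt0 // mul1r.
by rewrite pmulr_rgt0 // ltr0n.
Qed.

Let in_boxP p : dist zeta0 p <= rho -> in_box p.1 p.2.
Proof. by rewrite distC /dist /in_box /= subr0. Qed.

Let kappa_gt0 : 0 < kappa.
Proof. by rewrite /kappa mulr_gt0 // exprn_gt0 // divr_gt0. Qed.

Let kappa_rho : kappa * rho <= 1 / 4.
Proof.
localize_hypotheses.
have k4 : kappa = (4 * ((tau / 12) ^+ 4))^-1.
  by rewrite /kappa; field; rewrite gt_eqF.
have t4 : 0 < (tau / 12) ^+ 4 by rewrite exprn_gt0 // divr_gt0.
rewrite k4 mulrC ler_pdivrMr ?mulr_gt0 //; apply: (le_trans rho_tau4).
by rewrite mulrA mul1r mulVf ?mul1r // pnatr_eq0.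
Qed.

Let q := 2 * kappa / n%:R.

Let q_ge0 : 0 <= q.
Proof. by rewrite divr_ge0 // mulr_ge0 // ltW. Qed.

Let q_rho : q * rho <= 1 / (2 * n%:R).
Proof.
localize_hypotheses; have kr := kappa_rho; have r0 := rho_gt0.
have np : 0 < n%:R :> R by rewrite ltr0n.
rewrite /q ler_pdivlMr ?mulr_gt0 //.
have -> : 2 * kappa / n%:R * rho * (2 * n%:R) = 4 * (kappa * rho).
  by field; rewrite gt_eqF.
lra.
Qed.

Let q_half : q <= 1 / 2.
Proof.
localize_hypotheses; have kr := kappa_rho; have r0 := rho_gt0.
have np : 0 < n%:R :> R by rewrite ltr0n.
have : 1 <= n%:R * rho.
  apply: (le_trans _ rho_ln); apply: ler_wpDl.
    by rewrite ln_ge0 // ler_pdivlMr ?mulr_gt0 // mul1r.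
  by apply: le_trans (pi_ge2 R); rewrite ler1n.
have : q * rho * n%:R <= 1 / 2.
  have -> : 1 / 2 = 1 / (2 * n%:R) * n%:R :> R by field; rewrite gt_eqF.
  by rewrite ler_wpM2r // ltW.
move: q_ge0; set m := n%:R * rho; have -> : q * rho * n%:R = q * m.
  by rewrite /m; ring.
nra.
Qed.

Let step_dist p p' : dist zeta0 p <= rho -> dist zeta0 p' <= rho ->
    dist p p' <= rho ->
  dist p' (step p p') <= q * dist p p' /\
  cexp (N2 * (step p p').1) (N2 * (step p p').2) =
    cexp (N2 * p'.1) (N2 * p'.2) * (Rfl p' / Rfl p).
Proof.
localize_hypotheses; have kr := kappa_rho; have r0 := rho_gt0.
move=> /in_boxP b1 /in_boxP b2 d.
have lip := refl_lipschitz b2 b1.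
rewrite -/(Rfl p) -/(Rfl p') -/(dist p' p) distC in lip.
have d0 : 0 <= dist p p' by rewrite addr_ge0.
have small : normc (Rfl p' / Rfl p - 1) <= 1 / 2.
  apply: (le_trans lip); apply: (@le_trans _ _ (kappa * rho)); last lra.
  by rewrite ler_pM2l.
have [e l] := clogP small; split; last first.
  rewrite [in RHS]e -cexpD /step /= !mulrDr.
  by rewrite -!mulrA ![N2 * (_ / N2)]mulrC !divfK ?gt_eqF.
rewrite /dist /step /= !opprD !addrA !subrr !sub0r !normrN !normrM.
rewrite -mulrDl normN2V ler_pdivrMr ?N2_gt0 //.
apply: (le_trans l); rewrite -/(dist p p').
have -> : q * dist p p' * N2 = 4 * (kappa * dist p p').
  by rewrite /q /N2 natrM; field; rewrite pnatr_eq0 -lt0n.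
by rewrite ler_pM2l.
Qed.

Let zeta_ex : exists zeta1, [/\ cexp (N2 * zeta1.1) (N2 * zeta1.2) = Rfl zeta0,
   dist zeta0 zeta1 <= rho / 2 & `|zeta1.2 - theta| <= pi / N2].
Proof.
localize_hypotheses.
have box : in_box zeta0.1 zeta0.2.
  by apply: in_boxP; rewrite /dist !subrr normr0 addr0 ltW.
have [lo up] := refl_norm box.
have [b bpi e] := clog_ex (refl_neq0 box).
set r := normc (refl _ _) in lo up e.
have r0 : 0 < r by apply: lt_le_trans lo; rewrite divr_gt0 // mulr_gt0.
have lnr : `|ln r| <= ln (36 / (h * tau)).
  rewrite ler0_norm ?ln_le0 // -lnV ?posrE // ler_ln ?posrE ?invr_gt0 //.
    rewrite -[leRHS]invrK lef_pV2 ?posrE ?invr_gt0 ?divr_gt0 ?mulr_gt0 //.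
    by rewrite invf_div.
  by rewrite divr_gt0 // mulr_gt0.
exists (ln r / N2, theta + b / N2); split => /=.
- rewrite mulrDr ![N2 * (_ / N2)]mulrC !divfK ?gt_eqF //.
  by rewrite -[ln r]add0r cexpD theta_period mul1r -e.
- rewrite /dist /= sub0r opprD addrA subrr sub0r !normrN !normrM -mulrDl.
  rewrite normN2V ler_pdivrMr ?N2_gt0 //.
  have -> : rho / 2 * N2 = n%:R * rho by rewrite /N2 natrM; field.
  by apply: le_trans rho_ln; rewrite lerD.
- rewrite addrAC subrr add0r normrM normN2V.
  by rewrite ler_pM2r ?invr_gt0.
Qed.

Let ge0_pow2 k : 0 < 2 ^+ k :> R. Proof. by rewrite exprn_gt0. Qed.

(** For [theta] in [2 pi Z / n] away from [0], the equation
    [nu^(2n) = reflection h nu w] has a solution [nu = e^(a + i b)] with [b]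
    close to [theta]. It is the limit of the iteration
    [nu_(k+1)^(2n) = reflection h nu_k w_k] started at [e^(i theta)], which
    contracts because the [2n]-th root divides relative errors by [2n]. *)
Lemma resonance_ex : exists a b w,
  [/\ dispersion h (cexp a b) w, cexp a b ^+ (2 * n) = reflection h (cexp a b) w,
      in_box a b & `|b - theta| <= (pi + 1) / (2 * n%:R)].
Proof.
have [zeta1 [z1e z1d z1pi]] := zeta_ex.
pose s := fix s k := if k is k'.+1 then ((s k').2, step (s k').1 (s k').2)
                     else (zeta0, zeta1).
(* The second bound, measured from [zeta1], pins the argument of the limit. *)
have inv k : [/\ dist (s k).1 (s k).2 <= rho / 2 / 2 ^+ k,
    dist zeta1 (s k).2 <= q * rho * (1 - 1 / 2 ^+ k),
    dist zeta0 (s k).1 <= rho &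
    cexp (N2 * (s k).2.1) (N2 * (s k).2.2) = Rfl (s k).1].
  elim: k => [|k [D1 D2 D3 D4]].
    rewrite /= expr0 !divr1 subrr mulr0; split=> //.
      by rewrite /dist !subrr normr0 addr0.
    by rewrite /dist !subrr normr0 addr0 ltW.
  have p2 := ge0_pow2 k.
  have i1 : 0 < 1 / 2 ^+ k :> R by apply: divr_gt0.
  have i2 : 1 / 2 ^+ k <= 1 :> R by rewrite ler_pdivrMr // mul1r exprn_ege1 // ler1n.
  have D5 : dist zeta0 (s k).2 <= rho.
    apply: (le_trans (dist_triangle _ zeta1 _)).
    have a1 : q * rho <= 1 / 2 * rho by rewrite ler_wpM2r // ltW.
    have a2 : 0 <= q * rho * (1 / 2 ^+ k) 
      by apply: mulr_ge0 (ltW i1); exact: mulr_ge0 q_ge0 (ltW rho_gt0).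
    by move: D2; rewrite mulrBr mulr1; lra.
  have D6 : dist (s k).1 (s k).2 <= rho.
    apply: (le_trans D1); rewrite -[leRHS]mulr1 -mulrA ler_wpM2l ?(ltW rho_gt0) //.
    by move: i1 i2; rewrite mul1r => ? ?; lra.
  have [sd se] := step_dist D3 D5 D6.
  have sd' : dist (s k).2 (step (s k).1 (s k).2) <= q * (rho / 2 * (1 / 2 ^+ k)).
    by apply: (le_trans sd); rewrite ler_wpM2l // mul1r.
  have e2 : 1 / 2 ^+ k.+1 = 1 / 2 ^+ k / 2 :> R.
    by rewrite exprS; field; rewrite gt_eqF.
  rewrite /=; split=> //.
  - have -> : rho / 2 / 2 ^+ k.+1 = rho / 2 * (1 / 2 ^+ k.+1) by rewrite mul1r.
    rewrite e2; apply: (le_trans sd').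
    have rt : 0 <= rho / 2 * (1 / 2 ^+ k).
      by apply: mulr_ge0 (ltW i1); rewrite divr_ge0 // ltW.
    by have := ler_wpM2r rt q_half; lra.
  - apply: (le_trans (dist_triangle _ (s k).2 _)); rewrite e2.
    by move: D2 sd'; set t := 1 / 2 ^+ k; lra.
  - rewrite se D4 mulrCA mulfV ?mulr1 //.
    by apply: refl_neq0; apply: in_boxP.
pose u k := (s k).1.
have uS k : u k.+1 = (s k).2 by [].
have ud k : dist (u k.+1) (u k) <= rho / 2 / 2 ^+ k by rewrite distC; case: (inv k).
have [a Ha] : exists l, forall k, `|(u k).1 - l| <= 2 * (rho / 2) / 2 ^+ k.
  by apply: geometric_cauchy => k; apply: le_trans (ud k); rewrite lerDl.
have [b Hb] : exists l, forall k, `|(u k).2 - l| <= 2 * (rho / 2) / 2 ^+ k.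
  by apply: geometric_cauchy => k; apply: le_trans (ud k); rewrite lerDr.
have uab k : dist (u k) (a, b) <= 2 * rho / 2 ^+ k.
  rewrite /dist /=; have := lerD (Ha k) (Hb k).
  by have -> : 2 * (rho / 2) / 2 ^+ k + 2 * (rho / 2) / 2 ^+ k = 2 * rho / 2 ^+ k
    by field; rewrite gt_eqF.
have box : in_box a b.
  apply: (@in_boxP (a, b)); rewrite -subr_le0; apply: (@geometric_small _ (2 * rho) _ 0).
  move=> k _; rewrite lerBlDr; apply: (le_trans (dist_triangle _ (u k) _)).
  by rewrite addrC lerD //; case: (inv k).
exists a, b, (decay a b); split=> //; first exact: decayP; last first.
  have : dist zeta1 (a, b) - q * rho <= 0.
    apply: (@geometric_small _ (2 * rho) _ 1) => -[//|k] _.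
    rewrite lerBlDr; apply: (le_trans (dist_triangle _ (u k.+1) _)).
    rewrite addrC lerD //; case: (inv k) => _ + _ _; move/le_trans; apply.
    apply: ler_piMr; first exact: mulr_ge0 q_ge0 (ltW rho_gt0).
    by rewrite gerBl divr_ge0 // exprn_ge0.
  have b1 : `|zeta1.2 - b| <= dist zeta1 (a, b) by rewrite /dist /= lerDr.
  have -> : b - theta = (zeta1.2 - theta) - (zeta1.2 - b) by ring.
  have := ler_normB (zeta1.2 - theta) (zeta1.2 - b).
  move: z1pi q_rho; rewrite /N2 natrM [(pi + 1) / _]mulrDl; lra.
rewrite cexpX -/N2 -/(refl a b).
apply/eqP; rewrite -subr_eq0; apply/eqP/eq0_normc/eqP.
rewrite eq_le normc_ge0 andbT.
pose K := expR (N2 * a) * (2 * N2) + kappa.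
have [k0 Hk0] : exists k0, forall k, (k0 <= k)%N -> N2 * (2 * rho / 2 ^+ k) <= 1 / 2.
  have c := cvg_div_pow2 (N2 * (2 * rho)).
  have /cvgrPdist_le/(_ (1 / 2)) := c; rewrite divr_gt0 // => /(_ isT)[k0 _ H].
  exists k0 => k kk; have := H k kk; rewrite /= sub0r normrN ger0_norm ?mulrA //.
  apply: divr_ge0; last exact: exprn_ge0.
  by rewrite !mulr_ge0 ?(ltW N2_gt0) ?(ltW rho_gt0).
apply: (@geometric_small _ (K * (2 * rho)) _ k0) => k kk.
have [_ _ D3 D4] := inv k.
have du := uab k.+1; have du' := uab k.
have le2 : 2 * rho / 2 ^+ k.+1 <= 2 * rho / 2 ^+ k.
  rewrite ler_pM2l ?mulr_gt0 // lef_pV2 ?posrE // exprS.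
  by rewrite ler_peMl ?ler1n // ltW.
set A := cexp (N2 * a) (N2 * b); set B := refl a b.
have -> : A - B = (A - cexp (N2 * (u k.+1).1) (N2 * (u k.+1).2)) + (Rfl (u k) - B).
  by rewrite uS D4 addrA subrK.
rewrite -[K * _ / _]mulrA mulrDl; apply: (le_trans (normcD_le _ _)).
apply: lerD.
  rewrite normc_distC.
  have e : `|N2 * (u k.+1).1 - N2 * a| + `|N2 * (u k.+1).2 - N2 * b|
      = N2 * dist (u k.+1) (a, b).
    by rewrite -!mulrBr !normrM (gtr0_norm N2_gt0) -mulrDr.
  apply: (le_trans (normc_cexp_dist _ _ _)).
    apply: le_trans (Hk0 k kk); apply: (@le_trans _ _ (N2 * dist (u k.+1) (a, b))).
      by rewrite -e lerDl.
    by rewrite ler_pM2l // (le_trans du).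
  rewrite e -[leRHS]mulrA ler_pM2l ?expR_gt0 // -[leRHS]mulrA ler_pM2l // ler_pM2l //.
  exact: le_trans le2.
have B1 : normc B <= 1 by case: (refl_norm box).
have B0 : B != 0 by exact: refl_neq0.
have -> : Rfl (u k) - B = (Rfl (u k) / B - 1) * B by field.
rewrite normcM; apply: (@le_trans _ _ (normc (Rfl (u k) / B - 1))).
  by rewrite ler_piMr ?normc_ge0.
apply: (le_trans (refl_lipschitz (in_boxP D3) box)).
by rewrite ler_pM2l.
Qed.

End Resonance.

(** * Square-summable sequences *)

Section SquareNorm.
Context {R : realType}.
Implicit Types (u v : l2 R) (x y : nat -> C R) (B K : R).

Definition sqsum x N : R := \sum_(0 <= k < N) normc (x k) ^+ 2.

Lemma sqsumS x N : sqsum x N.+1 = sqsum x N + normc (x N) ^+ 2.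
Proof. by rewrite /sqsum big_nat_recr. Qed.

Lemma sqsum_ge0 x N : 0 <= sqsum x N.
Proof. by apply: sumr_ge0 => k _; rewrite sqr_ge0. Qed.

Lemma sqsum_le x y N : (forall k, (k < N)%N -> normc (x k) ^+ 2 <= normc (y k) ^+ 2) ->
  sqsum x N <= sqsum y N.
Proof.
by move=> H; rewrite /sqsum !big_mkord; apply: ler_sum => k _; exact: H.
Qed.

Lemma sqsum_mono x N M : (N <= M)%N -> sqsum x N <= sqsum x M.
Proof.
move=> /subnKC <-; elim: (M - N)%N => [|d IH]; first by rewrite addn0.
by rewrite addnS sqsumS (le_trans IH) // lerDl sqr_ge0.
Qed.

Lemma sqnorm_leP x B : (sqnorm x <= B%:E)%E <-> forall N, sqsum x N <= B.
Proof.
split=> [H N|H].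
  rewrite -lee_fin /sqsum -sumEFin; apply: le_trans H.
  by apply: nneseries_lim_ge => k _ _; exact: sqnorm_term_ge0.
apply: lime_le; first by apply: is_cvg_nneseries => k *; exact: sqnorm_term_ge0.
by apply: nearW => N; rewrite sumEFin lee_fin; exact: H.
Qed.

Lemma square_summableP x :
  reflect (exists B, forall N, sqsum x N <= B) (x \in square_summable).
Proof.
rewrite unfold_in; apply: (iffP idP) => [|[B /sqnorm_leP]].
  have : (0 <= sqnorm x)%E by apply: nneseries_ge0 => k *; exact: sqnorm_term_ge0.
  case E : (sqnorm x) => [r| |] // _ _.
  by exists r; apply/sqnorm_leP; rewrite E.
by move=> /le_lt_trans; apply; rewrite ltry.
Qed.

Definition sqn u : R := fine (sqnorm u).

Lemma sqnE u : sqnorm u = (sqn u)%:E.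
Proof.
have := valP u; rewrite unfold_in => H; rewrite /sqn fineK // fin_numE.
rewrite (lt_eqF H) andbT gt_eqF // (lt_le_trans (ltNyr 0)) //.
by apply: nneseries_ge0 => k *; exact: sqnorm_term_ge0.
Qed.

Lemma sqsum_le_sqn u N : sqsum u N <= sqn u.
Proof. by move: N; apply/sqnorm_leP; rewrite -sqnE. Qed.

Lemma sqn_le u B : (forall N, sqsum u N <= B) -> sqn u <= B.
Proof. by move=> /sqnorm_leP; rewrite sqnE lee_fin. Qed.

Lemma sqn_ge0 u : 0 <= sqn u.
Proof. exact: le_trans (sqsum_ge0 u 0) (sqsum_le_sqn u 0). Qed.

Lemma coord_le_sqn u k : normc (u k) ^+ 2 <= sqn u.
Proof. by apply: le_trans (sqsum_le_sqn u k.+1); rewrite sqsumS lerDr sqsum_ge0. Qed.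

Lemma sqsumD_le x y N : sqsum (fun k => x k + y k) N <= 2 * sqsum x N + 2 * sqsum y N.
Proof.
rewrite /sqsum !mulr_sumr -big_split /=; apply: ler_sum => k _.
exact: normc_sqrD.
Qed.

Lemma sqsumZ a x N : sqsum (fun k => a * x k) N = normc a ^+ 2 * sqsum x N.
Proof.
by rewrite /sqsum mulr_sumr; apply: eq_bigr => k _; rewrite normcM exprMn.
Qed.

Lemma sqnD_le u v : sqn (u + v) <= 2 * sqn u + 2 * sqn v.
Proof.
apply: sqn_le => N; apply: (le_trans (sqsumD_le u v N)).
by rewrite lerD // ler_pM2l // sqsum_le_sqn.
Qed.

Lemma sqnZ_le (a : C R) u : sqn (a *: u) <= normc a ^+ 2 * sqn u.
Proof.
apply: sqn_le => N; rewrite [leLHS](sqsumZ a u N).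
by rewrite ler_wpM2l ?sqr_ge0 // sqsum_le_sqn.
Qed.

(** The constant comes from iterating [|a + b|^2 <= 2 |a|^2 + 2 |b|^2], hence is
    exponential in [n]. *)
Lemma sqn_sum_le n (g : nat -> l2 R) : exists2 K, 0 <= K &
  forall (c : nat -> C R) B, (forall k, normc (c k) ^+ 2 <= B) ->
    sqn (\sum_(k < n) c k *: g k) <= K * B.
Proof.
elim: n => [|n [K K0 IH]].
  exists 0 => // c' B _; rewrite big_ord0 mul0r; apply: sqn_le => N.
  by rewrite /sqsum big1 // => k _; rewrite [normc _](@normc0 R) expr0n.
exists (2 * K + 2 * sqn (g n)); first by rewrite addr_ge0 // mulr_ge0 // sqn_ge0.
move=> c' B HB; rewrite big_ord_recr /=; apply: (le_trans (sqnD_le _ _)).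
rewrite [leRHS]mulrDl -[2 * K * B]mulrA -[2 * _ * B]mulrA.
apply: lerD; apply: ler_wpM2l => //; first exact: IH.
apply: (le_trans (sqnZ_le _ _)); rewrite mulrC ler_wpM2l ?sqn_ge0 //; exact: HB.
Qed.

Lemma bounded_op_sqn (S : l2 R -> l2 R) K : 0 <= K ->
  (forall u, sqn (S u) <= K * sqn u) -> bounded_op S.
Proof.
move=> K0 H; exists (Num.sqrt K) => u; rewrite /l2norm -!/(sqn _) -sqrtrM //.
by rewrite ler_wsqrtr.
Qed.

(** Because [r < 1], summing this over a recursion [x_(k+1) = y_(k+1) + w x_k], in
    either direction, bounds [sum |x_k|^2] by a multiple of [sum |y_k|^2]. *)
Lemma normc_sqr_contract (w : R[i]) : normc w < 1 ->
  exists p r, [/\ 0 <= p, 0 <= r, r < 1 &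
    forall a b : R[i], normc (a + w * b) ^+ 2 <= p * normc a ^+ 2 + r * normc b ^+ 2].
Proof.
move=> w1; set t := normc w in w1; have t0 : 0 <= t by exact: normc_ge0.
exists (1 - t)^-1, t; split=> // [|a b]; first by rewrite invr_ge0 subr_ge0 ltW.
have h : normc (a + w * b) <= normc a + t * normc b.
  by rewrite -normcM normcD_le.
have := normc_ge0 (a + w * b); move: h; move: (normc_ge0 a) (normc_ge0 b).
set A := normc a; set B := normc b; set X := normc _ => A0 B0 XAB X0.
have s0 : 0 < 1 - t by lra.
apply: (@le_trans _ _ ((A + t * B) ^+ 2)).
  by rewrite ler_pXn2r ?nnegrE // addr_ge0 // mulr_ge0.
have e : (1 - t) * ((1 - t)^-1 * A ^+ 2 + t * B ^+ 2) = A ^+ 2 + (1 - t) * t * B ^+ 2.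
  by field; rewrite gt_eqF.
rewrite -(ler_pM2l s0) e -subr_ge0.
have -> : A ^+ 2 + (1 - t) * t * B ^+ 2 - (1 - t) * (A + t * B) ^+ 2 =
  t * (A - (1 - t) * B) ^+ 2 by ring.
by rewrite mulr_ge0 // sqr_ge0.
Qed.

Lemma forward_solve (w : R[i]) : normc w < 1 -> exists2 K, 0 <= K &
  forall v, exists u : l2 R, [/\ u 0%N = v 0%N, (forall k, u k.+1 = v k.+1 + w * u k)
                       & sqn u <= K * sqn v].
Proof.
move=> w1; have [p [r [p0 r0 r1 H]]] := normc_sqr_contract w1.
exists (p / (1 - r)); first by rewrite divr_ge0 // subr_ge0 ltW.
move=> v.
pose x := fix x k : C R := if k is k'.+1 then v k'.+1 + w * x k' else v 0%N.
have p1 : normc (v 0%N) ^+ 2 <= p * normc (v 0%N) ^+ 2.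
  by have := H (v 0%N) 0; rewrite mulr0 addr0 normc0 expr0n mulr0 addr0.
have bound N : sqsum x N <= p / (1 - r) * sqn v.
  have a : sqsum x N.+1 <= p * sqsum v N.+1 + r * sqsum x N.
    elim: N => [|N IH]; first by rewrite !sqsumS /sqsum !big_geq // mulr0 addr0 !add0r.
    rewrite sqsumS [sqsum v _]sqsumS [X in _ + r * X]sqsumS !mulrDr.
    by rewrite addrACA lerD //; exact: H.
  have b := sqsum_mono x (leqnSn N).
  have c := sqsum_le_sqn v N.+1.
  rewrite mulrAC ler_pdivlMr ?subr_gt0 //.
  apply: (@le_trans _ _ (p * sqsum v N.+1)); last by rewrite ler_wpM2l.
  lra.
have sx : x \in square_summable by apply/square_summableP; exists (p / (1 - r) * sqn v).
by exists (L2 sx); split=> //; apply: sqn_le => N; exact: bound.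
Qed.

(** The recursion run backwards has the solution [sum_j w^j v_(k+j)]. *)
Lemma backward_series (w : R[i]) (x : nat -> C R) B : normc w < 1 ->
    (forall k, normc (x k) <= B) ->
  exists y : nat -> C R, (forall k, y k = x k + w * y k.+1) /\
    forall k, normc (y k) <= 2 * (B / (1 - normc w)).
Proof.
move=> w1 xB; have w0 := normc_ge0 w.
pose s k N : R[i] := \sum_(0 <= j < N) w ^+ j * x (k + j)%N.
have B0 : 0 <= B by apply: le_trans (xB 0%N); exact: normc_ge0.
have lim (f : R[i] -> R) : (forall a b, f (a + b) = f a + f b) ->
    (forall a, `|f a| <= normc a) -> forall k, exists2 l,
      (fun N => f (s k N)) @ \oo --> l & `|l| <= B / (1 - normc w).
  move=> fD fn k; pose g j := f (w ^+ j * x (k + j)%N).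
  have f0 : f 0 = 0.
    by have := fD 0 0; rewrite addr0 => /eqP; rewrite eq_sym -subr_eq0 addrK => /eqP.
  have fs N : f (s k N) = series g N.
    rewrite /s /series /=; elim: N => [|N IH]; first by rewrite !big_geq.
    by rewrite !big_nat_recr //= fD IH.
  have gB j : `|g j| <= geometric B (normc w) j.
    apply: (le_trans (fn _)); rewrite normcM normcX /geometric /= mulrC.
    by rewrite ler_wpM2r ?exprn_ge0.
  have gc : cvgn (series (geometric B (normc w))).
    by apply: is_cvg_geometric_series; rewrite ger0_norm.
  have nc : cvgn [normed series g].
    apply: (series_le_cvg _ _ gB gc) => j; first exact: normr_ge0.
    exact: le_trans (gB j).
  have c : cvgn (series g) by exact: normed_cvg.
  exists (limn (series g)).
    by rewrite (_ : (fun N => _) = series g) //; apply/funext => N; exact: fs.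
  apply: (le_trans (lim_series_norm nc)).
  have wn : `|normc w| < 1 by rewrite ger0_norm.
  rewrite -(cvg_lim _ (@cvg_geometric_series R B _ wn)) //.
  by apply: ler_lim => //; apply: nearW => N; rewrite /series /= ler_sum.
have /choice[lr Hr] : forall k, exists l,
    (fun N => complex.Re (s k N)) @ \oo --> l /\ `|l| <= B / (1 - normc w).
  move=> k.
  by have [l ? ?] := lim (@complex.Re R) (@Re_add R) (@normc_Re R) k; exists l.
have /choice[li Hi] : forall k, exists l,
    (fun N => complex.Im (s k N)) @ \oo --> l /\ `|l| <= B / (1 - normc w).
  move=> k.
  by have [l ? ?] := lim (@complex.Im R) (@Im_add R) (@normc_Im R) k; exists l.
exists (fun k => lr k +i* li k); split=> k; last first.
  apply: (le_trans (normc_ReIm _)); rewrite mulr_natl mulr2n /=.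
  by rewrite lerD //; [case: (Hr k)|case: (Hi k)].
have rec N : s k N.+1 = x k + w * s k.+1 N.
  rewrite /s big_nat_recl // expr0 mul1r addn0 mulr_sumr; congr (_ + _).
  by apply: eq_bigr => j _; rewrite exprS mulrA addSnnS.
have [r0 _] := Hr k; have [i0 _] := Hi k.
have [r1 _] := Hr k.+1; have [i1 _] := Hi k.+1.
apply: eq_complexP; rewrite ?Re_add ?Im_add ?Re_mul ?Im_mul /=.
  have r2 : (fun N => complex.Re (s k N.+1)) @ \oo --> lr k.
    by rewrite (cvg_shiftS (fun N => complex.Re (s k N))).
  apply: (cvg_unique _ r2) => //.
  rewrite (_ : (fun N => _) = fun N => complex.Re (x k) +
    (complex.Re w * complex.Re (s k.+1 N) - complex.Im w * complex.Im (s k.+1 N))).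
    by apply: cvgD; [exact: cvg_cst|apply: cvgB; apply: cvgM => //; exact: cvg_cst].
  by apply/funext => N; rewrite rec Re_add Re_mul.
have i2 : (fun N => complex.Im (s k N.+1)) @ \oo --> li k.
  by rewrite (cvg_shiftS (fun N => complex.Im (s k N))).
apply: (cvg_unique _ i2) => //.
rewrite (_ : (fun N => _) = fun N => complex.Im (x k) +
  (complex.Re w * complex.Im (s k.+1 N) + complex.Im w * complex.Re (s k.+1 N))).
  by apply: cvgD; [exact: cvg_cst|apply: cvgD; apply: cvgM => //; exact: cvg_cst].
by apply/funext => N; rewrite rec Im_add Im_mul.
Qed.

(** Telescoping [|y_k|^2 <= p |v_k|^2 + r |y_(k+1)|^2] leaves the boundary term
    [|y_N|^2], which the uniform bound of [backward_series] controls. *)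
Lemma backward_solve (w : R[i]) : normc w < 1 -> exists2 K, 0 <= K &
  forall v, exists u : l2 R, (forall k, u k = v k + w * u k.+1) /\ sqn u <= K * sqn v.
Proof.
move=> w1; have [p [r [p0 r0 r1 H]]] := normc_sqr_contract w1.
have w2 : 0 < 1 - normc w by rewrite subr_gt0.
pose b2 := (2 / (1 - normc w)) ^+ 2.
have b20 : 0 <= b2 by rewrite sqr_ge0.
exists ((p + r * b2) / (1 - r)).
  by rewrite divr_ge0 ?subr_ge0 ?(ltW r1) // addr_ge0 // mulr_ge0.
move=> v; pose B := Num.sqrt (sqn v).
have vB k : normc (v k) <= B.
  rewrite -(ler_pXn2r (n := 2)) ?nnegrE ?normc_ge0 ?sqrtr_ge0 //.
  by rewrite sqr_sqrtr ?sqn_ge0 // coord_le_sqn.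
have [y [yE yB]] := backward_series w1 vB.
have yB2 k : normc (y k) ^+ 2 <= b2 * sqn v.
  rewrite -[sqn v]sqr_sqrtr ?sqn_ge0 // /b2 -exprMn -/B.
  rewrite ler_pXn2r ?nnegrE ?normc_ge0 //.
    by rewrite mulrAC -mulrA; exact: yB.
  by rewrite mulr_ge0 ?sqrtr_ge0 // divr_ge0 // ltW.
have bound N : sqsum y N <= (p + r * b2) / (1 - r) * sqn v.
  have a : sqsum y N <= p * sqsum v N + r * (sqsum y N + normc (y N) ^+ 2).
    elim: N => [|N IH].
      by rewrite /sqsum !big_geq // mulr0 !add0r mulr_ge0 // sqr_ge0.
    have h := H (v N) (y N.+1); rewrite -yE in h.
    move: IH h; rewrite !sqsumS; lra.
  rewrite mulrAC ler_pdivlMr ?subr_gt0 //.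
  have c : p * sqsum v N <= p * sqn v by rewrite ler_wpM2l // sqsum_le_sqn.
  have d : r * normc (y N) ^+ 2 <= r * (b2 * sqn v) by rewrite ler_wpM2l.
  lra.
have sy : y \in square_summable.
  by apply/square_summableP; exists ((p + r * b2) / (1 - r) * sqn v).
by exists (L2 sy); split=> //; apply: sqn_le => N; exact: bound.
Qed.

End SquareNorm.

(** * Spectral theory of a finitely supported potential *)

Section Operator.
Context {R : realType}.
Implicit Types (u v f : l2 R) (q z w : C R).

(** The operators [J n alpha] are the case [q = i n^-alpha]. *)
Definition step_op n q : {linear l2 R -> l2 R} :=
  laplacian R \+ (q \*: Defs.proj n).

(** The value at [k - 1], with the Dirichlet condition at the left end. *)
Definition left_val (x : nat -> C R) k : C R := if k is j.+1 then x j else 0.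

Definition pot n q k : C R := if (k < n)%N then q else 0.

Lemma step_opE n q z u k :
  shift_op (step_op n q) z u k = left_val u k + u k.+1 + pot n q k * u k - z * u k.
Proof.
transitivity (left_val u k + u k.+1 + q * (if (k < n)%N then u k else 0) - z * u k).
  by [].
by rewrite /pot; case: ifP; rewrite ?mulr0 ?mul0r.
Qed.

Lemma l2_addE u v k : (u + v) k = u k + v k. Proof. by []. Qed.
Lemma l2_oppE u k : (- u) k = - u k. Proof. by []. Qed.
Lemma l2_scaleE a u k : (a *: u) k = a * u k. Proof. by []. Qed.
Lemma l2_zeroE k : (0 : l2 R) k = 0. Proof. by []. Qed.

Lemma l2_sumE m (g : 'I_m -> l2 R) k : (\sum_(j < m) g j) k = \sum_(j < m) g j k.
Proof. exact: (big_morph (fun v : l2 R => v k)). Qed.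

Lemma l2_ext u v : (forall k, u k = v k) -> u = v.
Proof. by move=> H; apply/val_inj/funext. Qed.

Lemma shift_op_linear n q z (a : C R) u v :
  shift_op (step_op n q) z (a *: u + v) =
  a *: shift_op (step_op n q) z u + shift_op (step_op n q) z v.
Proof.
apply: l2_ext => k; rewrite -[RHS]/(a * shift_op (step_op n q) z u k +
  shift_op (step_op n q) z v k) !step_opE.
by rewrite /left_val; case: k => [|k]; rewrite !l2_addE !l2_scaleE; ring.
Qed.

Lemma shift_op0 n q z : shift_op (step_op n q) z 0 = 0.
Proof.
by rewrite -[X in shift_op _ _ X](addNr 0) -scaleN1r shift_op_linear scaleN1r addNr.
Qed.

(** The free operator is a product of two triangular Toeplitz operators:
    with [L] and [L'] the left and right shifts, [L L' = 1] and hence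
    [L + L' - w - 1/w = - (1 - w L) (1 - w L') / w]. *)
Lemma free_resolvent w : w != 0 -> normc w < 1 ->
  exists G : l2 R -> l2 R, exists2 K : R, 0 <= K & forall f, sqn (G f) <= K * sqn f /\
    forall k, left_val (G f) k + G f k.+1 - (w + w^-1) * G f k = f k.
Proof.
move=> w0 w1.
have [K1 K10 H1] := backward_solve w1; have [K2 K20 H2] := forward_solve w1.
have /choice[G HG] : forall f : l2 R, exists u : l2 R,
    sqn u <= normc w ^+ 2 * (K2 * K1) * sqn f /\
    forall k, left_val u k + u k.+1 - (w + w^-1) * u k = f k.
  move=> f; have [y [yE yK]] := H1 f; have [x [x0 xS xK]] := H2 y.
  exists ((- w) *: x); split.
    apply: (le_trans (sqnZ_le _ _)); rewrite normc_opp -mulrA.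
    rewrite ler_wpM2l ?sqr_ge0 //; apply: (le_trans xK); rewrite -mulrA.
    by rewrite ler_wpM2l.
  have xE k : x k = y k + w * left_val x k by case: k => [|k]; rewrite ?x0 ?mulr0 ?addr0 // xS.
  move=> k; have -> : left_val ((- w) *: x) k = - w * left_val x k.
    by case: k => [|k] //=; rewrite mulr0.
  have e1 := yE k; have e2 := xE k; have e3 := xS k.
  rewrite !l2_scaleE e3.
  have -> : y k.+1 = (y k - f k) / w by rewrite e1; field.
  have -> : y k = x k - w * left_val x k by rewrite e2; ring.
  by field.
by exists G, (normc w ^+ 2 * (K2 * K1)) => //; rewrite mulr_ge0 ?sqr_ge0 // mulr_ge0.
Qed.

(** The moduli of such a sequence do not decrease beyond [m], so its partial sums
    of squares grow linearly unless [y_m = 0]. *)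
Lemma sqsum_growing (y : nat -> C R) w m (B : R) : w != 0 -> normc w < 1 ->
  (forall k, (m <= k)%N -> y k.+1 = w^-1 * y k) -> (forall N, sqsum y N <= B) -> y m = 0.
Proof.
move=> w0 w1 rec yB.
have wV : 1 <= normc w^-1 by rewrite normcV invf_ge1 ?normc_gt0 // ltW.
have gr j : normc (y m) <= normc (y (m + j)%N).
  elim: j => [|j IH]; first by rewrite addn0.
  by rewrite addnS rec ?leq_addr // normcM (le_trans IH) // ler_peMl // normc_ge0.
have low N : N%:R * normc (y m) ^+ 2 <= sqsum y (m + N)%N.
  elim: N => [|N IH]; first by rewrite mul0r sqsum_ge0.
  rewrite addnS sqsumS -natr1 mulrDl mul1r lerD //.
  by rewrite ler_pXn2r ?nnegrE ?normc_ge0.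
apply: eq0_normc; apply/eqP; rewrite -sqrf_eq0 eq_le sqr_ge0 andbT.
rewrite leNgt; apply/negP => p.
have B0 : 0 <= B by apply: le_trans (yB 0%N); exact: sqsum_ge0.
have := archi_boundP (divr_ge0 B0 (ltW p)); set N := Num.bound _.
rewrite ltr_pdivrMr // => /lt_geF; rewrite (le_trans (low _)) //.
Qed.

(** A solution of the free equation combines [w^k] and [w^-k]. The difference
    [u_(k+1) - w u_k] eliminates the former and is multiplied by [w^-1] at each
    step, so it vanishes in [l2]. *)
Lemma l2_tail w u m : w != 0 -> normc w < 1 ->
  (forall k, (m < k)%N -> left_val u k + u k.+1 = (w + w^-1) * u k) ->
  u m.+1 = w * u m.
Proof.
move=> w0 w1 H.
pose y k : C R := u k.+1 + (- w) * u k.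
suff : y m = 0 by rewrite /y mulNr => /eqP; rewrite subr_eq0 => /eqP.
apply: (@sqsum_growing y w m (2 * sqn u + 2 * (normc (- w) ^+ 2 * sqn u))) => //.
  move=> k mk; rewrite /y; have := H k.+1 mk; rewrite /left_val => e.
  have -> : u k.+2 = (w + w^-1) * u k.+1 - u k by rewrite -e addrC addKr.
  by field.
move=> N; apply: (le_trans (sqsumD_le (fun k => u k.+1) (fun k => - w * u k) N)).
rewrite lerD // ler_pM2l //.
  apply: le_trans (sqsum_le_sqn u N.+1).
  by rewrite /sqsum [leRHS]big_nat_recl // lerDr sqr_ge0.
by rewrite sqsumZ ler_wpM2l ?sqr_ge0 // sqsum_le_sqn.
Qed.

Section ThreeTerm.
Variable A : comNzRingType.

Fixpoint ttr_pair (a : nat -> A) (c : A) k : A * A :=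
  if k is k'.+1 then
    let p := ttr_pair a c k' in (a k' * p.1 - c * p.2, p.1)
  else (1, 0).

(** The solution [x_0 = 1] of [x_(k+1) + c x_(k-1) = a_k x_k]. It is
    stated over a ring so as to serve for numbers and for polynomials. *)
Definition ttr a c k := (ttr_pair a c k).1.

Lemma ttr_rec a c k :
  ttr a c k.+1 = a k * ttr a c k - c * (if k is j.+1 then ttr a c j else 0).
Proof. by case: k. Qed.

Lemma ttr_ind (P : nat -> A -> Prop) a c :
  P 0%N 1 -> P 1%N (a 0%N) ->
  (forall k, P k (ttr a c k) -> P k.+1 (ttr a c k.+1) ->
     P k.+2 (a k.+1 * ttr a c k.+1 - c * ttr a c k)) ->
  forall k, P k (ttr a c k).
Proof.
move=> P0 P1 PS k.
suff : P k (ttr a c k) /\ P k.+1 (ttr a c k.+1) by case.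
elim: k => [|k [IH1 IH2]].
  by split=> //; rewrite /ttr /= mulr1 mulr0 subr0.
by split=> //; rewrite [ttr a c k.+2]ttr_rec; exact: PS.
Qed.

End ThreeTerm.

Section Spectrum.
Variables (m : nat) (q : C R).
Local Notation n := m.+1.
Local Notation b := (pot n q).
Local Notation T := (step_op n q).

(** The solution of [(T - z) x = 0] with [x_0 = 1]. *)
Definition sol z k : C R := ttr (fun k => z - b k : R[i]) 1 k.

Lemma sol_rec z k : left_val (sol z) k + sol z k.+1 + b k * sol z k - z * sol z k = 0.
Proof. by rewrite /sol ttr_rec mul1r; case: k => [|k] /=; ring. Qed.

(** No summability is assumed: the recursion determines [x] from [x_0]. *)
Lemma formal_unique z (x : nat -> C R) :
  (forall k, left_val x k + x k.+1 + b k * x k - z * x k = 0) ->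
  forall k, x k = x 0%N * sol z k.
Proof.
move=> H k.
suff : x k = x 0%N * sol z k /\ x k.+1 = x 0%N * sol z k.+1 by case.
elim: k => [|k [IH1 IH2]].
  have h := H 0%N; have s := sol_rec z 0%N; rewrite /left_val in h s.
  have s0 : sol z 0 = 1 by [].
  rewrite s0 mulr1; split=> //.
  have -> : x 1%N = (z - b 0%N) * x 0%N.
    by apply/eqP; rewrite -subr_eq0; apply/eqP; rewrite -h; ring.
  have -> : sol z 1%N = (z - b 0%N) * sol z 0%N.
    by apply/eqP; rewrite -subr_eq0; apply/eqP; rewrite -s; ring.
  by rewrite s0; ring.
split=> //; have h := H k.+1; have s := sol_rec z k.+1; rewrite /left_val in h s.
have -> : x k.+2 = (z - b k.+1) * x k.+1 - x k.
  by apply/eqP; rewrite -subr_eq0; apply/eqP; rewrite -h; ring.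
have -> : sol z k.+2 = (z - b k.+1) * sol z k.+1 - sol z k.
  by apply/eqP; rewrite -subr_eq0; apply/eqP; rewrite -s; ring.
by rewrite IH1 IH2; ring.
Qed.

(** [z = w + 1/w] is an eigenvalue exactly when [jost w] vanishes: the solution
    [sol] then continues as a multiple of [w^k] past the support. *)
Definition jost w : C R := sol (w + w^-1) n - w * sol (w + w^-1) m.

Lemma pot_tail k : (m < k)%N -> b k = 0.
Proof. by move=> mk; rewrite /pot ltnNge mk. Qed.

Lemma shift_op_inj w u : w != 0 -> normc w < 1 -> jost w != 0 ->
  shift_op T (w + w^-1) u = 0 -> u = 0.
Proof.
move=> w0 w1 D0 e.
have rec k : left_val u k + u k.+1 + b k * u k - (w + w^-1) * u k = 0.
  by rewrite -step_opE e.
have uE := formal_unique rec.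
have tail : u n = w * u m.
  apply: l2_tail => // k mk; have := rec k.
  by rewrite pot_tail // mul0r addr0 => /eqP; rewrite subr_eq0 => /eqP.
have u0 : u 0%N = 0.
  move: tail; rewrite (uE n) (uE m) => /eqP; rewrite -subr_eq0 => /eqP t.
  have : u 0%N * jost w = 0 by rewrite -t /jost; ring.
  by move/eqP; rewrite mulf_eq0 (negbTE D0) orbF => /eqP.
by apply: l2_ext => k; rewrite uE u0 mul0r.
Qed.

Lemma geometric_l2 w (x : nat -> C R) : normc w < 1 ->
  (forall k, (m <= k)%N -> x k.+1 = w * x k) -> x \in square_summable.
Proof.
move=> w1 H; have w0 := normc_ge0 w.
have s0 : 0 < 1 - normc w ^+ 2.
  by rewrite subr_gt0 expr_lt1.
apply/square_summableP; exists (sqsum x m + normc (x m) ^+ 2 / (1 - normc w ^+ 2)) => N.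
have tail j : sqsum x (m + j)%N <= sqsum x m +
    (normc (x m) ^+ 2 - normc (x (m + j)%N) ^+ 2) / (1 - normc w ^+ 2).
  elim: j => [|j IH]; first by rewrite addn0 subrr mul0r addr0.
  rewrite addnS sqsumS H ?leq_addr // normcM exprMn.
  apply: (le_trans (lerD IH (lexx _))); rewrite -addrA lerD2l.
  by rewrite ler_pdivlMr // mulrDl divfK ?gt_eqF //; lra.
apply: (@le_trans _ _ (sqsum x (m + N)%N)); first by apply: sqsum_mono; rewrite leq_addl.
apply: (le_trans (tail N)); rewrite lerD2l ler_pM2r ?invr_gt0 //.
by rewrite gerBl sqr_ge0.
Qed.

(** Solvability of [(T - z) g = e_j] inside the support of the potential: shoot
    from the left end and use [sol] to match the decaying solution at site [n]. *)
Lemma solve_delta w j : w != 0 -> normc w < 1 -> jost w != 0 -> (j < n)%N ->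
  exists g : l2 R, forall k,
    shift_op T (w + w^-1) g k = (if k == j then 1 else 0).
Proof.
move=> w0 w1 D0 jn; set z := w + w^-1.
pose p := fix p k : C R * C R := if k is k'.+1 then
  ((if k' == j then 1 else 0) + (z - b k') * (p k').1 - (p k').2, (p k').1)
  else (0, 0).
pose P k := (p k).1.
have pE k : left_val P k + P k.+1 + b k * P k - z * P k = if k == j then 1 else 0.
  by rewrite /P; case: k => [|k] /=; ring.
pose s := - (P n - w * P m) / jost w.
pose x k : C R := P k + s * sol z k.
have xE k : left_val x k + x k.+1 + b k * x k - z * x k = if k == j then 1 else 0.
  transitivity ((left_val P k + P k.+1 + b k * P k - z * P k) +
    s * (left_val (sol z) k + sol z k.+1 + b k * sol z k - z * sol z k)).
    by rewrite /x; case: k => [|k]; rewrite /left_val; ring.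
  by rewrite pE sol_rec mulr0 addr0.
have match_ : x n = w * x m.
  apply/eqP; rewrite -subr_eq0; apply/eqP; rewrite /x.
  have -> : P n + s * sol z n - w * (P m + s * sol z m)
    = (P n - w * P m) + s * jost w by rewrite /jost -/z; ring.
  by rewrite /s mulNr -mulNr divfK // subrr.
have tail k : (m <= k)%N -> x k.+1 = w * x k.
  move=> /subnKC <-; elim: (k - m)%N => [|i IH]; first by rewrite addn0.
  have mi : (m < (m + i).+1)%N by rewrite ltnS leq_addr.
  have := xE (m + i).+1; rewrite pot_tail // mul0r addr0 /left_val gtn_eqF; last first.
    by rewrite (leq_trans jn).
  rewrite addnS IH => e; have -> : x (m + i).+2 = z * (w * x (m + i)%N) - x (m + i)%N.
    by apply/eqP; rewrite -subr_eq0; apply/eqP; rewrite -e; ring.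
  by rewrite /z; field.
have sx := geometric_l2 w1 tail.
by exists (L2 sx) => k; rewrite step_opE -xE.
Qed.

(** With [G] the free resolvent, [(T - z) (G f) = f + q P_n (G f)], and the
    defect is removed by the finitely many solutions of [solve_delta]. *)
Lemma resolvent_of_jost w : w != 0 -> normc w < 1 -> jost w != 0 ->
  resolvent_set T (w + w^-1).
Proof.
move=> w0 w1 D0; set z := w + w^-1.
have [G [K K0 HG]] := free_resolvent w0 w1.
have /choice[g Hg] : forall j, exists g : l2 R, (j < n)%N -> forall k,
    shift_op T z g k = (if k == j then 1 else 0).
  move=> j; have [jn|_] := boolP (j < n)%N; last by exists 0.
  by have [g Hg] := solve_delta w0 w1 D0 jn; exists g.
pose S f := G f - \sum_(j < n) (q * G f j) *: g j.
have TS f : shift_op T z (S f) = f.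
  apply: l2_ext => k.
  have -> : S f = (-1) *: (\sum_(j < n) (q * G f j) *: g j) + G f.
    by rewrite scaleN1r addrC.
  rewrite shift_op_linear scaleN1r l2_addE l2_oppE (step_opE _ _ _ (G f)).
  have -> : shift_op T z (\sum_(j < n) (q * G f j) *: g j) k = b k * G f k.
    have sumE i : (i <= n)%N -> shift_op T z (\sum_(j < i) (q * G f j) *: g j) k
        = if (k < i)%N then q * G f k else 0.
      elim: i => [_|i IH ilt].
        by rewrite big_ord0 shift_op0.
      rewrite big_ord_recr [X in shift_op _ _ X]addrC shift_op_linear l2_addE l2_scaleE Hg // IH ?(ltnW ilt) //.
      rewrite ltnS; case: ltngtP => ki; rewrite ?mulr0 ?mulr1 ?add0r ?addr0 //.
      by rewrite ki.
    by rewrite sumE // /pot; case: ifP => _; rewrite ?mul0r.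
  have [_ /(_ k)] := HG f; rewrite -/z => <-; ring.
have [K' K'0 HK'] := sqn_sum_le n g.
exists S; split.
- apply: (@bounded_op_sqn _ _ (2 * K + 2 * (K' * (normc q ^+ 2 * K)))).
    by rewrite addr_ge0 // !mulr_ge0 // ?normc_ge0.
  move=> f; have [Gf _] := HG f.
  rewrite /S -scaleN1r; apply: (le_trans (sqnD_le _ _)).
  rewrite [leRHS]mulrDl; apply: lerD; first by rewrite -mulrA ler_pM2l.
  rewrite -[leRHS]mulrA ler_pM2l //; apply: (le_trans (sqnZ_le _ _)).
  rewrite normc_opp normc1 expr1n mul1r -mulrA; apply: (HK' (fun j => q * G f j)) => k.
  rewrite normcM exprMn -[leRHS]mulrA ler_wpM2l ?sqr_ge0 //.
  exact: le_trans (coord_le_sqn _ _) Gf.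
- move=> u; apply/eqP; rewrite -subr_eq0; apply/eqP.
  apply: (@shift_op_inj w) => //; rewrite -/z -scaleN1r addrC shift_op_linear TS.
  by rewrite scaleN1r addNr.
- exact: TS.
Qed.

(** [w^n jost w] as a polynomial in [w]; it has constant term [1]. *)
Definition jost_rec : nat -> {poly R[i]} :=
  ttr (fun k => 1 + 'X ^+ 2 - (b k : R[i]) *: 'X) ('X ^+ 2).
Definition jost_poly : {poly R[i]} := jost_rec n - 'X ^+ 2 * jost_rec m.

Lemma jost_rec_horner w k : w != 0 ->
  (jost_rec k).[w] = w ^+ k * sol (w + w^-1) k.
Proof.
move=> w0.
have wv c : w * (w + w^-1 - c) = 1 + w ^+ 2 - c * w.
  by rewrite mulrBr mulrDr mulfV //; ring.
rewrite /jost_rec; apply: (@ttr_ind _ (fun k p => p.[w] = w ^+ k * sol (w + w^-1) k)).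
- by rewrite hornerC expr0 mul1r.
- by rewrite !(hornerD, hornerN, hornerM, hornerZ, hornerX, hornerXn, hornerC) /sol /ttr /= mulr1 mulr0 subr0 expr1 wv.
move=> {}k; move: (ttr _ _ k) (ttr _ _ k.+1) => p1 p2 e1 e2.
rewrite !(hornerD, hornerN, hornerM, hornerZ, hornerX, hornerXn, hornerC) e1 e2.
have := sol_rec (w + w^-1) k.+1; rewrite /left_val => s.
have -> : sol (w + w^-1) k.+2 = (w + w^-1 - b k.+1) * sol (w + w^-1) k.+1 - sol (w + w^-1) k.
  by apply/eqP; rewrite -subr_eq0; apply/eqP; rewrite -s; ring.
transitivity (w * (w + w^-1 - b k.+1) * (w ^+ k.+1 * sol (w + w^-1) k.+1)
  - w ^+ 2 * (w ^+ k * sol (w + w^-1) k)).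
  by rewrite wv.
by rewrite !exprS; ring.
Qed.

Lemma jost_poly_horner w : w != 0 -> jost_poly.[w] = w ^+ n * jost w.
Proof.
move=> w0; rewrite /jost_poly hornerD hornerN hornerM hornerXn !jost_rec_horner //.
by rewrite /jost exprS; ring.
Qed.

Lemma jost_poly_neq0 : jost_poly != 0.
Proof.
have H k : (jost_rec k).[0] = 1.
  rewrite /jost_rec; apply: (@ttr_ind _ (fun _ p => p.[0] = 1)); rewrite ?hornerC //.
    by rewrite !(hornerD, hornerN, hornerM, hornerZ, hornerX, hornerXn, hornerC) ?expr0n /=; ring.
  move=> {}k; move: (ttr _ _ k) (ttr _ _ k.+1) => p1 p2 e1 e2.
  by rewrite !(hornerD, hornerN, hornerM, hornerZ, hornerX, hornerXn, hornerC) e1 e2 ?expr0n /=; ring.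
apply/eqP => /(congr1 (fun p => p.[0])); rewrite /jost_poly hornerD hornerN hornerM !H.
by rewrite hornerXn expr0n /= mul0r subr0 horner0 => /eqP; rewrite oner_eq0.
Qed.

(** The exceptional points are the images under [w + 1/w] of the zeros of
    [jost_poly]. *)
Lemma resolvent_upper_half : exists s : seq (R[i]),
  forall z, 0 < complex.Im z -> z \notin s -> resolvent_set T z.
Proof.
have [rs rsE] := closed_field_poly_normal jost_poly.
exists [seq w + w^-1 | w <- rs] => z z0 zs.
have [w [w0 w1 _ wz]] := joukowski_inv z0.
rewrite -wz; apply: resolvent_of_jost => //.
apply: contra zs => /eqP D0; apply/mapP; exists w => //.
have : root jost_poly w by rewrite rootE jost_poly_horner // D0 mulr0.
by rewrite rsE rootZ ?lead_coef_eq0 ?jost_poly_neq0 // root_prod_XsubC.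
Qed.

Lemma resolvent_nearby z : 0 < complex.Im z ->
  exists2 r : R, 0 < r &
    forall z', normc (z' - z) < r -> z' != z -> resolvent_set T z'.
Proof.
move=> z0; have [s Hs] := resolvent_upper_half.
have [r [r0 Hr]] : exists r : R, 0 < r /\
    forall z', z' \in s -> z' != z -> r <= normc (z' - z).
  elim: s {Hs} => [|a s [r [r0 IH]]]; first by exists 1.
  have [->|az] := eqVneq a z.
    exists r; split=> // z'; rewrite inE => /predU1P[->|]; last exact: IH.
    by rewrite eqxx.
  exists (Num.min r (normc (a - z))); split.
    by rewrite lt_min r0 normc_gt0 subr_eq0.
  move=> z'; rewrite inE ge_min => /predU1P[->|zs] z'z; first by rewrite lexx orbT.
  by rewrite IH.
exists (Num.min r (complex.Im z)); first by rewrite lt_min r0.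
move=> z'; rewrite lt_min => /andP[zr zi] z'z; apply: Hs.
  have := le_lt_trans (normc_Im _) zi; rewrite Im_add Im_opp ltr_norml => /andP[].
  lra.
by apply/negP => /Hr /(_ z'z); rewrite leNgt zr.
Qed.

End Spectrum.
End Operator.

(** * Eigenvalues in the upper half-plane are discrete *)

Section RootSpace.
Context {R : realType}.
Variables (m : nat) (q : C R).
Local Notation n := m.+1.
Local Notation b := (pot n q).
Local Notation T := (step_op n q).
Implicit Types (z w : C R) (u : l2 R).

(** [sol (z + X)] as a polynomial in the increment [X]. Its coefficients are the
    formal generalised eigenvectors at [z]: applying [T - z] to the [j]-th one
    gives the one before. *)
Definition sol_poly z k : {poly R[i]} := ttr (fun k => (z - b k : R[i])%:P + 'X) 1 k.

Definition jordan z j k : C R := (sol_poly z k)`_j.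

Lemma jordan_rec z j k :
  left_val (jordan z j) k + jordan z j k.+1 + b k * jordan z j k - z * jordan z j k =
  left_val (fun i => jordan z i k) j.
Proof.
rewrite /jordan; case: k => [|k].
  have -> : sol_poly z 1 = (z - b 0%N : R[i])%:P + 'X.
    by rewrite /sol_poly /ttr /= mulr1 mulr0 subr0.
  have -> : sol_poly z 0 = 1 by [].
  move: (b 0%N) => c; rewrite coefD coefC coefX coef1 /left_val.
  case: j => [|[|j]]; rewrite ?coef1 /=.
  - by rewrite add0r addr0 !mulr1 subrK subrr.
  - by rewrite !mulr0 !add0r addr0 subr0.
  - by rewrite !mulr0 !addr0 subr0.
have -> : sol_poly z k.+2 =
    ((z - b k.+1 : R[i])%:P + 'X) * sol_poly z k.+1 - sol_poly z k.
  by rewrite [LHS]ttr_rec mul1r.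
rewrite /left_val; move: (b k.+1) (sol_poly z k.+1) (sol_poly z k) => c p2 p1.
rewrite coefB mulrDl coefD coefCM coefXM.
by case: j => [|j] /=; ring.
Qed.

Lemma jordan_low z j k : (k < j)%N -> jordan z j k = 0.
Proof.
rewrite /jordan /sol_poly; move: j.
apply: (@ttr_ind _ (fun k (p : {poly R[i]}) => forall j, (k < j)%N -> p`_j = 0 :> C R)).
- by move=> [|j] // _; rewrite coef1.
- by move=> [|[|j]] // _; rewrite coefD coefC coefX /= addr0.
move=> {}k; move: (ttr _ _ k) (ttr _ _ k.+1) => p1 p2 e1 e2 [|j] // kj.
rewrite mul1r coefB mulrDl coefD coefCM coefXM /= (e1 _ (ltnW (ltnW kj))).
by rewrite (e2 _ (ltnW kj)) (e2 j kj) mulr0 addr0 subr0.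
Qed.

Lemma jordan00 z : jordan z 0 0 = 1.
Proof. by rewrite /jordan coef1. Qed.

Lemma sol_poly_horner z (e : R[i]) k : (sol_poly z k).[e] = sol m q (z + e) k.
Proof.
pose x k : C R := (sol_poly z k).[e].
have x0 : x 0%N = 1 by rewrite /x hornerC.
have : forall k, left_val x k + x k.+1 + b k * x k - (z + e) * x k = 0.
  move=> {}k; rewrite /x [sol_poly z k.+1]ttr_rec mul1r -/(sol_poly z k).
  rewrite hornerD hornerN hornerM hornerD hornerC hornerX.
  by case: k => [|k]; rewrite /left_val ?horner0 -?/(sol_poly z k); ring.
by move=> /formal_unique /(_ k); rewrite -/(x k) x0 mul1r.
Qed.

(** Horner's scheme with [|a + b|^2 <= 2 |a|^2 + 2 |b|^2] at each step: a weighted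
    bound that can be summed over the sites term by term. *)
Lemma normc_horner_sqr_le (e : R[i]) (a : nat -> R[i]) N :
  normc (\sum_(j < N) a j * e ^+ j) ^+ 2 <=
  \sum_(j < N) 2 * (2 * normc e ^+ 2) ^+ j * normc (a j) ^+ 2.
Proof.
elim: N a => [|N IH] a; first by rewrite !big_ord0 normc0 expr0n.
rewrite !big_ord_recl /= !expr0 !mulr1.
have -> : \sum_(i < N) a (bump 0 i) * e ^+ bump 0 i =
    e * \sum_(i < N) a i.+1 * e ^+ i.
  by rewrite mulr_sumr; apply: eq_bigr => i _; rewrite /bump /= exprS; ring.
apply: (le_trans (normc_sqrD _ _)); rewrite lerD // normcM exprMn.
apply: (@le_trans _ _ (2 * (normc e ^+ 2 * \sum_(i < N) 2 * (2 * normc e ^+ 2) ^+ i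
    * normc (a i.+1) ^+ 2))).
  by rewrite ler_pM2l // ler_wpM2l ?sqr_ge0 //; exact: (IH (fun i => a i.+1)).
rewrite !mulr_sumr; apply: ler_sum => i _; rewrite -[bump 0 i]/(i.+1).
rewrite (exprS (2 * normc e ^+ 2)).
by rewrite le_eqVlt; apply/orP; left; apply/eqP; ring.
Qed.

Lemma eigenvalue_spectrum z : eigenvalues T z -> spectrum T z.
Proof.
move=> [u u0 Tu] [S [_ SK _]]; move/negP: u0; apply.
rewrite -(SK u) -(SK 0) shift_op0 /shift_op Tu subrr; exact: eqxx.
Qed.

Lemma free_injective w u : w != 0 -> normc w < 1 ->
  (forall k, left_val u k + u k.+1 = (w + w^-1) * u k) -> u = 0.
Proof.
move=> w0 w1 H; have t := @l2_tail _ w u 0 w0 w1 (fun k _ => H k).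
have u0 : u 0%N = 0.
  have := H 0%N; rewrite /left_val add0r t mulrDl => /eqP.
  by rewrite -subr_eq0 opprD addrA subrr sub0r oppr_eq0 mulf_eq0 invr_eq0 (negbTE w0) => /eqP.
apply: l2_ext => k; rewrite l2_zeroE.
suff : u k = 0 /\ u k.+1 = 0 by case.
elim: k => [|k [IH1 IH2]]; first by rewrite t u0 mulr0.
by split=> //; have := H k.+1; rewrite /left_val IH1 IH2 mulr0 add0r.
Qed.

(** An infinite Jordan chain would make [z + e] an eigenvalue for all small [e]:
    past the support each chain element is the free resolvent applied to the
    previous one, so the chain grows at most geometrically and
    [sum_j e^j jordan z j] is square-summable. *)
Lemma jordan_chain_finite z : 0 < complex.Im z ->
  exists j, jordan z j \notin square_summable.
Proof.
move=> z0; apply: contrapT => H.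
have sj j : jordan z j \in square_summable.
  by apply/negPn/negP => h; apply: H; exists j.
pose u j : l2 R := L2 (sj j).
have [w [w0 w1 _ wz]] := joukowski_inv z0.
have [G [K K0 HG]] := @free_resolvent R w w0 w1.
have uG j : (m <= j)%N -> u j.+1 = G (u j).
  move=> mj; suff : u j.+1 - G (u j) = 0 by move/eqP; rewrite subr_eq0 => /eqP.
  apply: (free_injective w0 w1) => k; have [_ /(_ k) g] := HG (u j).
  have e := jordan_rec z j.+1 k; rewrite [RHS]/= in e.
  have bz : b k * jordan z j.+1 k = 0.
    rewrite /pot; case: ltnP => kn; last by rewrite mul0r.
    by rewrite jordan_low ?mulr0 // (leq_trans kn).
  rewrite bz addr0 in e.
  have -> : left_val (u j.+1 - G (u j) : l2 R) k = left_val (u j.+1) k - left_val (G (u j)) k.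
    by case: (k) => [|i] //; rewrite /left_val subr0.
  rewrite !l2_addE !l2_oppE.
  have e' : left_val (u j.+1) k + u j.+1 k.+1 - z * u j.+1 k = u j k by exact: e.
  rewrite -wz in e'.
  apply/eqP; rewrite -subr_eq0; apply/eqP.
  transitivity ((left_val (u j.+1) k + u j.+1 k.+1 - (w + w^-1) * u j.+1 k) -
    (left_val (G (u j)) k + G (u j) k.+1 - (w + w^-1) * G (u j) k)); first by ring.
  by rewrite e' g subrr.
pose L := 1 + K; have L1 : 1 <= L by rewrite lerDl.
pose A := \sum_(j < n) sqn (u j).
have A0 : 0 <= A by apply: sumr_ge0 => j _; exact: sqn_ge0.
have growth j : sqn (u j) <= L ^+ j * A.
  elim: j => [|j IH].
    by rewrite mul1r /A big_ord_recl lerDl sumr_ge0 // => i _; exact: sqn_ge0.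
  have [mj|jm] := leqP m j.
    rewrite uG //; have [g _] := HG (u j); apply: (le_trans g).
    rewrite exprS -mulrA ler_pM // ?sqn_ge0 // lerDr //.
  apply: (@le_trans _ _ A); last by rewrite ler_peMl // exprn_ege1.
  rewrite /A (bigD1 (Ordinal (jm : (j.+1 < n)%N))) //= lerDl.
  by rewrite sumr_ge0 // => i _; exact: sqn_ge0.
have [r r0 Hr] := resolvent_nearby m q z0.
have L0 : 0 < L by lra.
have [e e0 [er eL]] : exists2 e : R, 0 < e & e < r /\ 2 * e ^+ 2 * L <= 1 / 2.
  exists (Num.min (r / 2) (1 / (2 * L))); first by rewrite lt_min !divr_gt0 // mulr_gt0.
  set e := Num.min _ _.
  have e1 : e <= r / 2 by rewrite ge_min lexx.
  have e2 : e <= 1 / (2 * L) by rewrite ge_min lexx orbT.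
  have e0 : 0 <= e by rewrite le_min !divr_ge0 // ?(ltW r0) // mulr_ge0 // ltW.
  split; first by lra.
  rewrite ler_pdivlMr ?mulr_gt0 // in e2.
  have e3 : e * L <= 1 / 2 by lra.
  have e4 : e <= 1 / 2.
    by apply: le_trans e3; rewrite ler_peMr.
  have -> : 2 * e ^+ 2 * L = 2 * (e * (e * L)) by ring.
  have : e * (e * L) <= 1 / 2 * (1 / 2) by rewrite ler_pM // mulr_ge0 // ltW.
  lra.
pose x k : C R := sol m q (z + e%:C) k.
have xsum k M : (k < M)%N -> x k = \sum_(j < M) jordan z j k * e%:C ^+ j.
  move=> kM; rewrite /x -sol_poly_horner; apply: horner_coef_wide.
  by apply/leq_sizeP => j Mj; apply: jordan_low; apply: leq_trans Mj.
have sx : x \in square_summable.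
  apply/square_summableP; exists (4 * A) => M.
  have t : sqsum x M <= \sum_(j < M) 2 * (2 * e ^+ 2) ^+ j * sqsum (jordan z j) M.
    under eq_bigr => j _ do rewrite /sqsum mulr_sumr.
    rewrite exchange_big /= /sqsum !big_mkord; apply: ler_sum => k _.
    rewrite (xsum k M) //.
    have := normc_horner_sqr_le e%:C (fun j => jordan z j k) M.
    by rewrite normc_real gtr0_norm.
  apply: (le_trans t).
  apply: (@le_trans _ _ (\sum_(j < M) 2 * A * (1 / 2) ^+ j)).
    apply: ler_sum => j _.
    apply: (@le_trans _ _ (2 * (2 * e ^+ 2) ^+ j * (L ^+ j * A))).
      apply: ler_wpM2l; last exact: le_trans (sqsum_le_sqn (u j) M) (growth j).
      by rewrite mulr_ge0 // exprn_ge0 // mulr_ge0 // sqr_ge0.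
    have -> : 2 * (2 * e ^+ 2) ^+ j * (L ^+ j * A) = 2 * A * (2 * e ^+ 2 * L) ^+ j.
      by rewrite [(_ * L) ^+ j]exprMn; ring.
    apply: ler_wpM2l; first by rewrite mulr_ge0.
    by rewrite lerXn2r ?nnegrE ?divr_ge0 // !mulr_ge0 ?sqr_ge0 // ltW.
  have geo : \sum_(j < M) (1 / 2 : R) ^+ j = 2 - 2 * (1 / 2) ^+ M.
    elim: (M) => [|i IH]; first by rewrite big_ord0 expr0 mulr1 subrr.
    by rewrite big_ord_recr /= IH exprS; field.
  rewrite -mulr_sumr geo.
  have : 0 <= (1 / 2 : R) ^+ M by rewrite exprn_ge0 // divr_ge0.
  by set t' := _ ^+ M; nra.
have ev : eigenvalues T (z + e%:C).
  exists (L2 sx).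
    apply/eqP => /(congr1 (fun v : l2 R => v 0%N)) /eqP.
    by rewrite /= /x /sol /ttr /= oner_eq0.
  apply/eqP; rewrite -subr_eq0; apply/eqP; apply: l2_ext => k.
  by rewrite -[LHS]/(shift_op T (z + e%:C) (L2 sx) k) step_opE; exact: sol_rec.
apply: (eigenvalue_spectrum ev); apply: Hr.
  by rewrite addrC addKr normc_real gtr0_norm.
by rewrite -subr_eq0 addrC addKr -normc_gt0 normc_real gtr0_norm.
Qed.

(** With [d] the first index for which [jordan z d] is not square-summable, the
    root space is spanned by the [d] earlier ones: a root vector is a
    combination of formal ones, whose top coefficient must vanish. *)
Lemma root_space_finite z : 0 < complex.Im z -> finite_dimensional (root_space T z).
Proof.
move=> z0; have ex := jordan_chain_finite z0.
pose d := ex_minn ex.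
have [dn dmin] : jordan z d \notin square_summable /\
    forall j, (j < d)%N -> jordan z j \in square_summable.
  rewrite /d; case: ex_minnP => d' H1 H2; split=> // j jd.
  by apply: contraT => /H2; rewrite leqNgt jd.
pose e (i : 'I_d) : l2 R := L2 (dmin i (ltn_ord i)).
exists d, e => u [N uN].
suff [a Ha] : exists a : nat -> C R, forall k, u k = \sum_(i < d) a i * jordan z i k.
  by exists (fun i => a i); apply: l2_ext => k; rewrite l2_sumE Ha; exact: eq_bigr.
elim: N u uN => [|N IH] u.
  rewrite /= => ->; exists (fun=> 0) => k; rewrite big1 // => i _.
  by rewrite mul0r.
rewrite iterSr => /IH[a Ha].
pose a' i : C R := if i is i'.+1 then a i' else u 0%N.
have uE k : u k = \sum_(i < d.+1) a' i * jordan z i k.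
  pose y k : C R := u k - \sum_(i < d) a i * jordan z i.+1 k.
  have yrec i : left_val y i + y i.+1 + b i * y i - z * y i = 0.
    have -> : left_val y i = left_val u i - \sum_(j < d) a j * left_val (jordan z j.+1) i.
      rewrite /y; case: i => [|i] //=; rewrite big1 ?subr0 // => j _.
      by rewrite mulr0.
    have h := Ha i; rewrite step_opE in h.
    transitivity ((left_val u i + u i.+1 + b i * u i - z * u i) -
      \sum_(j < d) a j * (left_val (jordan z j.+1) i + jordan z j.+1 i.+1 +
         b i * jordan z j.+1 i - z * jordan z j.+1 i)).
      rewrite /y; under [in RHS]eq_bigr => j _ do
        rewrite mulrBr !mulrDr [a j * (b i * _)]mulrCA [a j * (z * _)]mulrCA.
      by rewrite sumrB !big_split /= -!mulr_sumr; ring.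
    rewrite h; under [X in _ - X]eq_bigr => j _ do rewrite jordan_rec /=.
    by rewrite subrr.
  have solE : jordan z 0 k = sol m q z k.
    rewrite (formal_unique (m := m) (q := q) (z := z) (x := jordan z 0)) ?jordan00 ?mul1r //.
    by move=> i; exact: jordan_rec.
  have := formal_unique yrec k; rewrite -solE big_ord_recl /= => yE.
  have y0 : y 0%N = u 0%N.
    rewrite /y big1 ?subr0 // => i _; rewrite jordan_low ?mulr0 //.
  by rewrite -y0 -yE /y subrK.
(* All other terms of the expansion of [u] are square-summable. *)
have ad : a' d = 0.
  apply/eqP/negPn/negP => ad; move/negP: dn; apply.
  have -> : jordan z d = (a' d)^-1 *: ((l2_val u : nat -> C R) +
      \sum_(i < d) (- a' i) *: (jordan z i : nat -> C R)).
    apply/funext => k.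
    rewrite -[RHS]/((a' d)^-1 * (u k + (\sum_(i < d) (- a' i) *: (jordan z i : nat -> C R)) k)).
    rewrite fct_sumE uE big_ord_recr /=.
    have -> : \sum_(i < d) ((- a' i) *: (jordan z i : nat -> C R)) k =
        - \sum_(i < d) a' i * jordan z i k.
      by rewrite -sumrN; apply: eq_bigr => i _; rewrite -mulNr.
    by rewrite addrAC subrr add0r mulKf.
  rewrite rpredZ // rpredD ?(valP u) //.
  by apply: rpred_sum => i _; rewrite rpredZ // dmin.
by exists a' => k; rewrite uE big_ord_recr /= ad mul0r addr0.
Qed.

Lemma discrete_of_upper_eigenvalue z : 0 < complex.Im z -> eigenvalues T z ->
  discrete_spectrum T z.
Proof.
move=> z0 ez; have sz := eigenvalue_spectrum ez.
split=> //; last exact: root_space_finite.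
split; first by rewrite inE.
have [r r0 Hr] := resolvent_nearby m q z0.
exists (ball (z : C R) r%:C); first by apply: nbhsx_ballx; rewrite ltcR.
apply/seteqP; split=> [z' [zb sz']|z' ->]; last first.
  by split=> //; apply: ballxx; rewrite ltcR.
apply/eqP/negPn/negP => zz; apply: sz'; apply: Hr => //.
move: zb; rewrite /ball /= normc_def ltcR -normc_distC.
by case: (z - z').
Qed.

Lemma eigenvalue_of_jost w : w != 0 -> normc w < 1 -> jost m q w = 0 ->
  eigenvalues T (w + w^-1).
Proof.
move=> w0 w1 D0; set z := w + w^-1.
have tail k : (m <= k)%N -> sol m q z k.+1 = w * sol m q z k.
  move=> /subnKC <-; elim: (k - m)%N => [|i IH].
    by rewrite addn0; apply/eqP; rewrite -subr_eq0; apply/eqP.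
  have mi : (m < (m + i).+1)%N by rewrite ltnS leq_addr.
  have := sol_rec m q z (m + i).+1; rewrite pot_tail // mul0r addr0 /left_val.
  rewrite addnS IH => e.
  have -> : sol m q z (m + i).+2 = z * (w * sol m q z (m + i)%N) - sol m q z (m + i)%N.
    by apply/eqP; rewrite -subr_eq0; apply/eqP; rewrite -e; ring.
  by rewrite /z; field.
have sx := geometric_l2 w1 tail.
exists (L2 sx).
  apply/eqP => /(congr1 (fun v : l2 R => v 0%N)) /eqP.
  by rewrite /= /sol /ttr /= oner_eq0.
apply/eqP; rewrite -subr_eq0; apply/eqP; apply: l2_ext => k.
by rewrite -[LHS]/(shift_op T z (L2 sx) k) step_opE; exact: sol_rec.
Qed.

End RootSpace.

Section Resonances.
Context {R : realType}.

(** Inside the support the solution is [(nu^(k+1) - nu^-(k+1)) / (nu - nu^-1)];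
    continuing it by [w^k] is the equation [nu^(2n) (nu - w) = nu^-1 - w]. *)
Lemma discrete_of_resonance m (h : R) (nu w : R[i]) : 0 < h -> nu != 0 ->
    nu != nu^-1 -> 0 < complex.Im (nu + nu^-1 + 'i * h%:C) -> dispersion h nu w -> nu != w ->
    nu ^+ (2 * m.+1) = reflection h nu w ->
  discrete_spectrum (step_op m.+1 ('i * h%:C : C R)) (nu + nu^-1 + 'i * h%:C).
Proof.
move=> h0 nu0 nuV im d nuw e; have [w0 w1 _ wE] := d.
apply: discrete_of_upper_eigenvalue => //; rewrite -wE; apply: eigenvalue_of_jost => //.
set q := 'i * h%:C.
have dn : nu - nu^-1 != 0 by rewrite subr_eq0.
have solE k : (k <= m.+1)%N -> (nu - nu^-1) * sol m q (w + w^-1) k =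
    nu ^+ k.+1 - nu^-1 ^+ k.+1.
  suff H : ((k <= m.+1)%N -> (nu - nu^-1) * sol m q (w + w^-1) k =
      nu ^+ k.+1 - nu^-1 ^+ k.+1) /\
    ((k.+1 <= m.+1)%N -> (nu - nu^-1) * sol m q (w + w^-1) k.+1 =
      nu ^+ k.+2 - nu^-1 ^+ k.+2) by case: H.
  have pz j : (j <= m)%N -> w + w^-1 - pot m.+1 q j = nu + nu^-1.
    by move=> jm; rewrite /pot ltnS jm wE addrK.
  elim: k => [|k [IH1 IH2]].
    split=> _; rewrite /sol /ttr /= !mulr1 ?mulr0 ?subr0 ?pz //.
    by rewrite ?mul0r; field.
  split=> // km.
  rewrite /sol ttr_rec mul1r -!/(sol _ _ _ _) pz // mulrBr mulrCA IH2 ?(ltnW km) //.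
  rewrite IH1 ?(ltnW (ltnW km)) //.
  by rewrite !exprS; field.
have key : nu ^+ (2 * m.+1) * (nu - w) = nu^-1 - w.
  have dw : nu - w != 0 by rewrite subr_eq0.
  rewrite e /reflection -(dispersion_factor nu0 d).
  by field; rewrite dw nu0.
suff /eqP : (nu - nu^-1) * (jost m q w : R[i]) = 0.
  by rewrite mulf_eq0 (negbTE dn) => /eqP.
rewrite /jost mulrBr mulrCA !solE //.
have nm : nu ^+ m.+1 != 0 by rewrite expf_neq0.
apply: (mulfI nm); rewrite mulr0.
move: key; rewrite mul2n -addnn exprD.
have -> : nu^-1 ^+ m.+2 = nu^-1 / nu ^+ m.+1 by rewrite exprS exprVn.
rewrite exprVn [nu ^+ m.+2]exprS; set p := nu ^+ m.+1 in nm * => key.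
transitivity (p * p * (nu - w) - (nu^-1 - w)); first by field; rewrite nm nu0.
by rewrite key subrr.
Qed.

End Resonances.

(** * The trace norm of the potential *)

Section TraceNorm.
Context {R : realType}.
Implicit Types (u v : l2 R).

Lemma Re_conj (z : R[i]) : complex.Re (Num.conj z) = complex.Re z.
Proof. by case: z. Qed.
Lemma Im_conj (z : R[i]) : complex.Im (Num.conj z) = - complex.Im z.
Proof. by case: z. Qed.

Lemma mul_conjc (z : R[i]) : z * Num.conj z = (normc z ^+ 2)%:C.
Proof.
rewrite sqr_normcE.
by apply: eq_complexP; rewrite ?Re_mul ?Im_mul Re_conj Im_conj /=; ring.
Qed.

Lemma cvg_real_complex (x : nat -> R) (l : R) : x @ \oo --> l ->
  (fun k => (x k)%:C : C R) @ \oo --> (l%:C : C R).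
Proof.
move=> /cvgrPdist_lt H; apply/cvgrPdist_lt => e e0.
have ei : 0 < complex.Re e by move: e0; rewrite ltcE => /andP[].
have eE : e = (complex.Re e)%:C.
  by move: e0; rewrite ltcE => /andP[/eqP i0 _]; apply: eq_complexP.
have [N _ HN] := H _ ei; exists N => // k /HN.
by rewrite /= eE -rmorphB normc_def /= expr0n addr0 sqrtr_sqr ltcR.
Qed.

(** All the inner products that occur below reduce to [||v||^2] up to one
    extra term of the series. *)
Lemma inner_diag v : exists2 s : R, (forall N, sqsum v N <= s) &
  forall (a d : C R) k (f : nat -> C R),
    (forall j, f j = a * (normc (v j) ^+ 2)%:C + (if j == k then d else 0)) ->
  limn (series f) = a * s%:C + d.
Proof.
have cvg_sum : cvgn (sqsum v).
  apply: nondecreasing_is_cvgn; first by move=> N M; exact: sqsum_mono.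
  by exists (sqn v) => _ [N _ <-]; exact: sqsum_le_sqn.
exists (limn (sqsum v)).
  by move=> N; apply: nondecreasing_cvgn_le => // n1 n2; exact: sqsum_mono.
move=> a d k f fE; apply: cvg_lim => //.
have -> : series f = (fun N => a * ((sqsum v N)%:C : C R) + (if (k < N)%N then d else 0)).
  apply/funext; elim=> [|N IH].
    by rewrite /series /= !big_geq // /sqsum big_geq // mulr0 addr0.
  rewrite /series /= big_nat_recr //= -[X in X + _]/(series f N) IH fE sqsumS.
  rewrite rmorphD mulrDr ltnS addrACA; congr (_ + _).
  by case: ltngtP => _; rewrite ?add0r ?addr0.
apply: cvgD.
  by apply: cvgM; [exact: cvg_cst|exact: cvg_real_complex].
apply: (@cvg_trans _ ((fun=> d) @ \oo)); last exact: cvg_cst.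
by apply: near_eq_cvg; exists k.+1 => // N /= kN; rewrite kN.
Qed.

Lemma inner_finite (f : nat -> C R) N : (forall k, (N <= k)%N -> f k = 0) ->
  limn (series f) = \sum_(0 <= k < N) f k.
Proof.
move=> H; apply: cvg_lim => //.
apply: (@cvg_trans _ ((fun=> \sum_(0 <= k < N) f k) @ \oo)); last exact: cvg_cst.
apply: near_eq_cvg; exists N => // M /= NM.
rewrite /series /= [RHS](big_cat_nat (n := N)) //= [X in _ + X]big_nat_cond.
by rewrite [X in _ + X]big1 ?addr0 // => i /andP[/andP[iN _] _]; exact: H.
Qed.

Lemma std_basisE k j : std_basis k j = (j == k)%:R :> C R.
Proof. by []. Qed.

Lemma conj_bool (b : bool) : Num.conj (b%:R : C R) = b%:R.
Proof. by apply: eq_complexP; rewrite ?Re_conj ?Im_conj; case: b; rewrite /= ?oppr0. Qed.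

Lemma inner_std_basis u k : inner u (std_basis k) = u k.
Proof.
rewrite /inner (@inner_finite _ k.+1).
  rewrite big_nat_recr //= big_nat_cond big1 ?add0r; last first.
    by move=> j /andP[/andP[_ jk] _]; rewrite conj_bool (ltn_eqF jk) mulr0.
  by rewrite conj_bool eqxx mulr1.
by move=> j kj; rewrite std_basisE conj_bool gtn_eqF // mulr0.
Qed.

Section AbsOp.
Variables (n : nat) (c : R).
Hypothesis c0 : 0 < c.
Let V u : l2 R := ('i * c%:C : C R) *: Defs.proj n u.

Lemma proj_val u k : Defs.proj n u k = if (k < n)%N then u k else 0.
Proof. by []. Qed.

Lemma abs_op_ex : is_abs_op V (fun u => (c%:C : C R) *: Defs.proj n u).
Proof.
split.
- move=> a u v; apply: l2_ext => k.
  rewrite -[LHS]/(c%:C * (if (k < n)%N then a * u k + v k else 0)).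
  rewrite -[RHS]/(a * (c%:C * (if (k < n)%N then u k else 0)) +
    c%:C * (if (k < n)%N then v k else 0)).
  by case: ifP => _; ring.
- apply: (@bounded_op_sqn _ _ (c ^+ 2)); first exact: sqr_ge0.
  move=> u; apply: (le_trans (sqnZ_le _ _)); rewrite normc_real gtr0_norm //.
  rewrite ler_wpM2l ?sqr_ge0 //; apply: sqn_le => N.
  apply: le_trans (sqsum_le_sqn u N); apply: sqsum_le => k _; rewrite proj_val.
  by case: ifP => // _; rewrite (@normc0 R) expr0n sqr_ge0.
- move=> u; rewrite /inner.
  rewrite (_ : (fun k => _) = fun k => (if (k < n)%N then (c * normc (u k) ^+ 2)%:C else 0)).
    rewrite (@inner_finite _ n); last by move=> k nk; rewrite ltnNge nk.
    apply: sumr_ge0 => k _; case: ifP => _ //.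
    by rewrite ler0c mulr_ge0 ?sqr_ge0 // ltW.
  apply/funext => k.
  rewrite -[LHS]/(c%:C * (if (k < n)%N then u k else 0) * Num.conj (u k : R[i])).
  case: ifP => _; rewrite ?mulr0 ?mul0r // -mulrA mul_conjc.
  by apply: eq_complexP; rewrite ?Re_mul ?Im_mul /=; ring.
- move=> u v; rewrite /inner; congr (limn (series _)); apply/funext => k.
  rewrite -[LHS]/(c%:C * (if (k < n)%N then c%:C * (if (k < n)%N then u k else 0) else 0)
     * Num.conj (v k : R[i])).
  rewrite -[RHS]/(('i * c%:C) * (if (k < n)%N then u k else 0) *
     Num.conj (('i * c%:C) * (if (k < n)%N then v k else 0) : R[i])).
  case: (k < n)%N; rewrite ?mulr0 ?mul0r //.
  by apply: eq_complexP; rewrite !(Re_mul, Im_mul, Re_conj, Im_conj) /=; ring.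
Qed.

(** [|V| e_k = c e_k] for [k < n] because [(|V| + c) (|V| e_k - c e_k) = 0] while
    [|V| >= 0]; and [|V| e_k = 0] for [k >= n] because [|V|^2 e_k = 0], so that
    positivity on [e_k + t |V| e_k] for all real [t] forces [|V| e_k = 0]. *)
Lemma abs_op_diag A k : is_abs_op V A ->
  inner (A (std_basis k)) (std_basis k) = (if (k < n)%N then c%:C else 0).
Proof.
move=> [Alin _ Apos Asq]; set e := std_basis k.
have A0 : A 0 = 0.
  by have := Alin (-1) 0 0; rewrite scaleN1r oppr0 addr0 scaleN1r addNr.
have AD u v : A (u + v) = A u + A v by have := Alin 1 u v; rewrite !scale1r.
have AZ (a : C R) u : A (a *: u) = a *: A u by have := Alin a u 0; rewrite A0 !addr0.
have sq j : A (A e) j = if (k < n)%N then c%:C ^+ 2 * (j == k)%:R else 0.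
  rewrite -inner_std_basis Asq /inner (@inner_finite _ n).
    have f i : (V e i : C R) * Num.conj (V (std_basis j) i : R[i]) =
        if (i == k) && (i == j) && (i < n)%N then c%:C ^+ 2 else 0.
      rewrite -[V e i]/(('i * c%:C) * (if (i < n)%N then (i == k)%:R else 0)).
      rewrite -[V _ i]/(('i * c%:C) * (if (i < n)%N then (i == j)%:R else 0)).
      case: ifP => _; rewrite ?mulr0 ?mul0r ?andbF //.
      rewrite andbT; case: (i == k); case: (i == j) => /=;
      by apply: eq_complexP; rewrite !(Re_mul, Im_mul, Re_conj, Im_conj) /=; ring.
    under eq_bigr => i _ do rewrite f.
    have [kn|kn] := ltnP k n.
      rewrite big_mkord (bigD1 (Ordinal kn)) //= eqxx kn andbT big1 ?addr0.
        by rewrite eq_sym; case: (j == k); rewrite ?mulr1 ?mulr0.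
      move=> i ik; have : (i : nat) != k by apply: contra ik => /eqP ik; apply/eqP/val_inj.
      by move/negbTE => ->.
    rewrite big_mkord big1 // => i _; rewrite (ltn_eqF (leq_trans (ltn_ord i) kn)) //.
  move=> i ni; rewrite -[V e i]/(('i * c%:C) * (if (i < n)%N then (i == k)%:R else 0)).
  by rewrite ltnNge ni mulr0 mul0r.
rewrite inner_std_basis; have [kn|kn] := ltnP k n.
  pose v : l2 R := A e - (c%:C : C R) *: e.
  have AAe : A (A e) = (c%:C ^+ 2 : C R) *: e by apply: l2_ext => j; rewrite sq kn.
  have Av : A v = (- c%:C : C R) *: v.
    rewrite /v AD -scaleN1r !AZ AAe scalerDr !scalerA addrC mulN1r; congr (_ + _).
    by congr (_ *: _); ring.
  have [s sle sE] := inner_diag v.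
  have := Apos v; rewrite Av /inner (@sE (- c%:C) 0 0%N); last first.
    by move=> j; rewrite if_same addr0 -mul_conjc mulrA.
  rewrite addr0 mulNr oppr_ge0 -rmorphM lecR pmulr_rle0 // => s0.
  have vk : v k = 0.
    apply: eq0_normc; apply/eqP; rewrite -sqrf_eq0 eq_le sqr_ge0 andbT.
    apply: le_trans s0; apply: le_trans (sle k.+1).
    by rewrite sqsumS lerDr sqsum_ge0.
  move/eqP: vk; rewrite -[v k]/(A e k - c%:C * (k == k)%:R) eqxx mulr1.
  by rewrite subr_eq0 => /eqP.
have AAe : A (A e) = 0 by apply: l2_ext => j; rewrite sq ltnNge kn.
have [s sle sE] := inner_diag (A e).
have pos (t : R) : 0 <= t * s + complex.Re (A e k).
  have := Apos (e + (t%:C : C R) *: A e); rewrite AD AZ AAe scaler0 addr0.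
  rewrite /inner (@sE t%:C (A e k) k); last first.
    move=> j; rewrite -mul_conjc.
    rewrite -[(e + _) j]/((j == k)%:R + t%:C * A e j).
    case: eqVneq => [->|_];
    by apply: eq_complexP; rewrite !(Re_add, Im_add, Re_mul, Im_mul, Re_conj, Im_conj) /=; ring.
  by rewrite lecE => /andP[_]; rewrite Re_add Re_mul /=; rewrite mul0r subr0.
have s0 : s <= 0.
  rewrite leNgt; apply/negP => sp.
  have := pos (- (complex.Re (A e k) + 1) / s); rewrite divfK ?gt_eqF //.
  lra.
apply: eq0_normc; apply/eqP; rewrite -sqrf_eq0 eq_le sqr_ge0 andbT.
apply: le_trans s0; apply: le_trans (sle k.+1).
by rewrite sqsumS lerDr sqsum_ge0.
Qed.

Lemma trace_norm_potential : trace_norm V = (n%:R * c)%:E.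
Proof.
have HA : is_abs_op V (abs_op V).
  by rewrite /abs_op; apply: (@xgetPex _ _ [set A | is_abs_op V A]); eexists; exact: abs_op_ex.
transitivity (\sum_(0 <= k <oo) (if (k < n)%N then c else 0)%:E)%E.
  by apply: eq_eseriesr => k _; rewrite (abs_op_diag _ HA); case: ifP.
rewrite (@nneseries_split _ _ 0 n); last first.
  by move=> k _; rewrite lee_fin; case: ifP => // _; exact: ltW.
rewrite [X in (_ + X)%E]eseries0 ?adde0; last first.
  by move=> k nk _; rewrite add0n in nk; rewrite ltnNge nk.
rewrite add0n sumEFin; congr EFin; rewrite big_mkord.
under eq_bigr => i _ do rewrite ltn_ord.
by rewrite sumr_const card_ord mulr_natl.
Qed.

End AbsOp.
End TraceNorm.

(** * Counting the resonances *)

Section Counting.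
Context {R : realType}.

Definition LT_term (z : C R) : R :=
  dist_segment z / Num.sqrt (normc (z ^+ 2 - 4)).

Lemma dist_segment_ge (z : C R) (t : R) :
  (forall x : R, t <= normc (z - x%:C)) -> t <= dist_segment z.
Proof.
move=> H; apply: lb_le_inf; last by move=> _ [x _ <-].
by exists (normc (z - 2%:C)); exists 2 => //=; rewrite in_itv /= lexx andbT; lra.
Qed.

Lemma dist_segment_Im (z : C R) : complex.Im z <= dist_segment z.
Proof.
apply: dist_segment_ge => x; apply: (le_trans (ler_norm _)).
by have := normc_Im (z - x%:C); rewrite Im_add Im_opp /= oppr0 addr0.
Qed.

Lemma sqr_sub4_neq0 (z : R[i]) : 0 < complex.Im z -> z ^+ 2 - 4 != 0.
Proof.
move=> z0; have -> : z ^+ 2 - 4 = (z - 2) * (z + 2) by ring.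
have im (t : R[i]) : complex.Im t = 0 -> z + t != 0.
  move=> t0; apply: contraTneq z0 => /(congr1 (@complex.Im R)).
  by rewrite Im_add t0 /= addr0 => ->; rewrite ltxx.
by apply: mulf_neq0; apply: im; rewrite ?Im_opp Im_add /= addr0 ?oppr0.
Qed.

(** As [z = nu + nu^-1 + i h], one has [z^2 - 4 = (nu - nu^-1)^2 + O(h)], and
    [nu - nu^-1 = O(theta)] when [log nu] is close to [i theta]; so
    [|z^2 - 4|^(1/2) = O(theta)], while the distance to [[-2, 2]] is at least
    [Im z]. *)
Lemma LT_term_resonance (h rho theta a b : R) : 0 < h -> h <= theta ^+ 2 ->
    0 < theta -> theta <= 1 / 2 -> rho <= theta -> rho <= 1 / 4 ->
    in_box rho theta a b ->
    h / 2 <= complex.Im (cexp a b + (cexp a b)^-1 + 'i * h%:C) ->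
  h / (34 * theta) <= LT_term (cexp a b + (cexp a b)^-1 + 'i * h%:C).
Proof.
move=> h0 ht t0 t1 rt r1 box im; rewrite /in_box in box.
set nu := cexp a b in im *; set z := nu + nu^-1 + 'i * h%:C in im *.
have nu0 : nu != 0 by exact: cexp_neq0.
have nuV : nu^-1 = cexp (- a) (- b).
  by apply: (mulfI nu0); rewrite mulfV // -cexpD !subrr cexp0.
have b0 := normr_ge0 (b - theta).
have a1 : `|a| <= 1 / 4 by lra.
have a2 : `|- a| <= 1 / 2 by rewrite normrN; lra.
have e1 : expR (- a) <= 2.
  by have := le_trans (ler_norm _) (expR_sub1_le a2); rewrite normrN; lra.
have e2 : expR a <= 2.
  have a3 : `|a| <= 1 / 2 by lra.
  by have := le_trans (ler_norm _) (expR_sub1_le a3); lra.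
have bt : `|b| <= `|b - theta| + theta.
  by have := ler_normD (b - theta) theta; rewrite subrK (gtr0_norm t0).
have diff : normc (nu - nu^-1) <= 16 * theta.
  rewrite nuV; have d2 : `|a - - a| <= 1 / 2.
    by rewrite opprK; have := ler_normD a a; lra.
  apply: (le_trans (normc_cexp_dist _ _ d2)); rewrite !opprK.
  have da := ler_normD a a; have db := ler_normD b b.
  have : 0 <= expR (- a) by exact: expR_ge0.
  have : 2 * (`|a + a| + `|b + b|) <= 8 * theta by lra.
  have : 0 <= 2 * (`|a + a| + `|b + b|) by rewrite mulr_ge0 // addr_ge0.
  set X := 2 * _ => X0 X1 E0; nra.
have zE : z ^+ 2 - 4 = (nu - nu^-1) ^+ 2 + (2 * (nu + nu^-1) * 'i * h%:C - (h ^+ 2)%:C).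
  have i2 : ('i * 'i : R[i]) = - 1 by exact: (sqr_i R).
  have -> : (h ^+ 2)%:C = - ('i * 'i) * (h%:C * h%:C) :> R[i].
    by rewrite i2 opprK mul1r -rmorphM -expr2.
  by rewrite /z; field.
have bound : normc (z ^+ 2 - 4) <= (17 * theta) ^+ 2.
  rewrite zE; apply: (le_trans (normcD_le _ _)); rewrite normcX.
  have d1 : normc (nu - nu^-1) ^+ 2 <= (16 * theta) ^+ 2.
    by rewrite ler_pXn2r ?nnegrE ?normc_ge0 ?mulr_ge0 ?(ltW t0).
  have d2 : normc (2 * (nu + nu^-1) * 'i * h%:C - (h ^+ 2)%:C) <= 8 * h + h ^+ 2.
    apply: (le_trans (normcB_le _ _)).
    rewrite !normcM normc_i !normc_real (gtr0_norm h0) (ger0_norm (sqr_ge0 h)) mulr1.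
    rewrite lerD2r ler_wpM2r ?(ltW h0) // normc_nat.
    have := normcD_le nu nu^-1; rewrite nuV !normc_cexp; lra.
  have h1 : h ^+ 2 <= h.
    have : theta ^+ 2 <= 1 by rewrite expr_le1 ?(ltW t0) //; lra.
    by move=> ?; rewrite expr2 ler_piMl ?(ltW h0) //; lra.
  rewrite !exprMn in d1 *; lra.
have hz : h / 2 <= dist_segment z by apply: le_trans (dist_segment_Im _).
have sz : Num.sqrt (normc (z ^+ 2 - 4)) <= 17 * theta.
  rewrite -[leRHS]ger0_norm ?mulr_ge0 ?(ltW t0) // -sqrtr_sqr.
  by apply: ler_wsqrtr.
have sz0 : 0 < Num.sqrt (normc (z ^+ 2 - 4)).
  by rewrite sqrtr_gt0 normc_gt0; apply: sqr_sub4_neq0; lra.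
rewrite /LT_term.
have -> : h / (34 * theta) = h / 2 / (17 * theta) by field; rewrite gt_eqF.
rewrite ler_pM ?divr_ge0 ?invr_ge0 ?mulr_ge0 ?(ltW h0) ?(ltW t0) //.
by rewrite lef_pV2 ?posrE ?mulr_gt0.
Qed.

(** The two solutions [nu] and [nu^-1] of [nu + nu^-1 = const] lie on opposite
    sides of the real axis. *)
Lemma cexp_joukowski_inj (a b a' b' : R) : 0 < sin b -> 0 < sin b' ->
    0 <= b <= pi -> 0 <= b' <= pi ->
  cexp a b + (cexp a b)^-1 = cexp a' b' + (cexp a' b')^-1 -> b = b'.
Proof.
move=> s0 s0' bi bi' e.
set nu := cexp a b in e; set nu' := cexp a' b' in e.
have n0 : nu != 0 by exact: cexp_neq0.
have n0' : nu' != 0 by exact: cexp_neq0.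
have : (nu - nu') * (nu * nu' - 1) = 0.
  transitivity ((nu + nu^-1 - (nu' + nu'^-1)) * (nu * nu')); last first.
    by rewrite e subrr mul0r.
  by field; rewrite n0 n0'.
move/eqP; rewrite mulf_eq0 !subr_eq0 => /orP[/eqP nn|/eqP nn].
  have ee : expR a = expR a'.
    by rewrite -(normc_cexp a b) -(normc_cexp a' b') -/nu nn.
  have := congr1 (@complex.Re R) nn; rewrite /= ee => /(mulfI _).
  by move=> /(_ (lt0r_neq0 (expR_gt0 _))) /cos_inj -> //; rewrite in_itv.
have : nu' = nu^-1 by apply: (mulfI n0); rewrite nn mulfV.
move/(congr1 (@complex.Im R)); rewrite Im_inv /= => eq.
have : 0 < expR a' * sin b' by rewrite mulr_gt0 ?expR_gt0.
rewrite eq; have : 0 < expR a * sin b / normc nu ^+ 2.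
  by rewrite divr_gt0 ?exprn_gt0 ?normc_gt0 // mulr_gt0 ?expR_gt0.
rewrite mulNr; lra.
Qed.

Lemma pi_le4 : pi <= 4 :> R.
Proof. by have [/andP[_]] := @pihalf_02_cos_pihalf R; lra. Qed.

(** Distinct [j] with [n tau <= j <= n / 16] give distinct eigenvalues: the
    argument of [nu] is determined up to [(pi + 1) / (2 n)], less than half the
    spacing [2 pi / n] of the starting points. The relation [h = tau^8] turns
    every smallness condition into one on [tau]. *)
Lemma LT_sum_ge m (tau : R) (J0 J1 : nat) : let n := m.+1 in let h := tau ^+ 8 in
    0 < tau -> tau <= 1 / 64 ->
    ln (36 / (h * tau)) + pi <= n%:R * (h / 12 ^+ 4) ->
    n%:R * tau <= J0%:R -> J1%:R <= n%:R / 16 :> R ->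
  ((\sum_(J0 <= j < J1) h * n%:R / 272 / j%:R)%R%:E <=
    \esum_(z in discrete_spectrum (step_op n ('i * h%:C : C R)%R)) (LT_term z)%:E)%E.
Proof.
move=> n h tau0 tau1 lnp J0n J1n.
have n0 : 0 < n%:R :> R by rewrite ltr0n.
have h0 : 0 < h by rewrite exprn_gt0.
have tau2 : tau ^+ 6 <= 1 / 4.
  rewrite exprS; have : tau ^+ 5 <= 1 by rewrite expr_le1 // ?(ltW tau0) //; lra.
  have : 0 <= tau ^+ 5 by rewrite exprn_ge0 // ltW.
  by set t := tau ^+ 5; nra.
have htau : h <= tau ^+ 2 / 4.
  have -> : h = tau ^+ 2 * tau ^+ 6 by rewrite -exprD.
  by rewrite -[leRHS]mulr1 -mulrA ler_wpM2l ?sqr_ge0 // mulr1 -[4^-1]mul1r.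
(* Small enough for both [h / 16] and [(tau / 12)^4], as [h = tau^8]. *)
pose rho := h / 12 ^+ 4.
have rho_h : rho <= h / 16.
  by rewrite ler_pM2l // lef_pV2 ?posrE ?exprn_gt0 // -!natrX ler_nat.
have rho_tau : rho <= (tau / 12) ^+ 4.
  rewrite expr_div_n ler_pM2r ?invr_gt0 ?exprn_gt0 //.
  have -> : h = tau ^+ 4 * tau ^+ 4 by rewrite -exprD.
  by rewrite ler_piMl ?exprn_ge0 ?(ltW tau0) // expr_le1 ?(ltW tau0) //; lra.
have pi4 := pi_le4; have pi2 := @pi_ge2 R.
pose theta j : R := 2 * pi * j%:R / n%:R.
have thetaP j : (J0 <= j < J1)%N -> 4 * tau <= theta j /\ theta j <= 1 / 2.
  move=> /andP[jl ju]; rewrite /theta; split.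
    rewrite ler_pdivlMr //.
    have jl' : J0%:R <= j%:R :> R by rewrite ler_nat.
    have : 2 * j%:R <= pi * j%:R :> R by rewrite ler_wpM2r.
    by move: J0n; set x := n%:R; set y := j%:R => ? ?; lra.
  rewrite ler_pdivrMr //.
  have ju' : j%:R <= J1%:R :> R by rewrite ler_nat ltnW.
  have : pi * j%:R <= 4 * j%:R :> R by rewrite ler_wpM2r.
  by move: J1n; set x := n%:R; set y := j%:R => ? ?; lra.
have period j : cexp 0 ((2 * n)%:R * theta j) = 1.
  have -> : (2 * n)%:R * theta j = (4 * j)%:R * pi.
    by rewrite /theta !natrM; field; rewrite gt_eqF.
  rewrite -[X in cexp X _](mulr0 (4 * j)%:R) -cexpX.
  have -> : cexp 0 pi = -1 :> R[i].
    by apply: eq_complexP; rewrite /= expR0 ?cospi ?sinpi ?mulrN ?mulr1 ?mulr0 ?oppr0.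
  by rewrite exprM -[4%N]/(2 * 2)%N exprM sqrrN !expr1n.
have res j : (J0 <= j < J1)%N -> exists z : C R, discrete_spectrum (step_op n ('i * h%:C : C R)) z /\
    h * n%:R / 272 / j%:R <= LT_term z /\
    exists a b, [/\ z = cexp a b + (cexp a b)^-1 + 'i * h%:C, 0 < sin b,
      0 <= b <= pi & `|b - theta j| <= (pi + 1) / (2 * n%:R)].
  move=> jJ; have [t1 t2] := thetaP j jJ.
  have tau3 : tau <= 1 / 16 by lra.
  have [a [b [w [d e box bt]]]] := resonance_ex (n := n) (ltn0Sn m) h0 htau
    tau0 tau3 t1 t2 rho_h rho_tau lnp (period j).
  have [i1 i2 i3 i4] := box_bounds h0 htau tau0 tau3 t1 t2 rho_h box.
  have [gap _] := dispersion_gap h0 htau tau0 i1 i2 d.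
  set nu := cexp a b in d e i1 i2 i3 i4 gap.
  have im0 : 0 < complex.Im nu by lra.
  have sb : 0 < sin b.
    by move: im0; rewrite /nu /= pmulr_rgt0 // expR_gt0.
  exists (nu + nu^-1 + 'i * h%:C); split; [|split].
  - apply: (@discrete_of_resonance R m h nu w) => //.
    + exact: cexp_neq0.
    + apply: contraTneq im0 => nuE; rewrite -leNgt nuE Im_inv.
      rewrite mulNr oppr_le0 divr_ge0 ?sqr_ge0 //; lra.
    + lra.
    + by rewrite -subr_eq0 -normc_gt0 (lt_le_trans tau0).
  - have tt0 : 0 < theta j by lra.
    have rt : rho <= tau.
      have : tau ^+ 2 <= tau by rewrite expr2 ler_piMl ?(ltW tau0) //; lra.
      lra.
    apply: (@le_trans _ _ (h / (34 * theta j))).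
      have j0 : 0 < j%:R :> R.
        move: tt0; rewrite /theta pmulr_lgt0 ?invr_gt0 // pmulr_rgt0 //.
        by rewrite mulr_gt0 //; lra.
      have -> : h / (34 * theta j) = h * n%:R / (68 * pi) / j%:R.
        by rewrite /theta; field; rewrite !gt_eqF //; lra.
      rewrite ler_pM2r ?invr_gt0 // ler_pM2l ?mulr_gt0 //.
      by rewrite lef_pV2 ?posrE ?mulr_gt0 //; lra.
    apply: (LT_term_resonance h0 _ tt0 t2 _ _ box i4); [|lra|lra].
    apply: (le_trans htau); have : tau ^+ 2 <= theta j ^+ 2.
      by rewrite ler_pXn2r ?nnegrE //; lra.
    have := sqr_ge0 tau; lra.
  - exists a, b; split=> //.
    move: box; rewrite /in_box => box; have a0 := normr_ge0 a.
    have : `|b - theta j| <= rho by lra.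
    have : rho <= tau.
      have : tau ^+ 2 <= tau by rewrite expr2 ler_piMl ?(ltW tau0) //; lra.
      lra.
    by rewrite ler_norml => ? /andP[? ?]; apply/andP; split; lra.
have /choice[z Hz] : forall j, exists z : C R, (J0 <= j < J1)%N ->
    discrete_spectrum (step_op n ('i * h%:C : C R)) z /\
    h * n%:R / 272 / j%:R <= LT_term z /\
    exists a b, [/\ z = cexp a b + (cexp a b)^-1 + 'i * h%:C, 0 < sin b,
      0 <= b <= pi & `|b - theta j| <= (pi + 1) / (2 * n%:R)].
  move=> j; have [jJ|_] := boolP (J0 <= j < J1)%N; last by exists 0.
  by have [z ?] := res j jJ; exists z.
have zinj : {in index_iota J0 J1 &, injective z}.
  move=> j j'; rewrite !mem_index_iota => jJ jJ' zz.
  have [_ [_ [a [b [zE s0 bp bt]]]]] := Hz j jJ.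
  have [_ [_ [a' [b' [zE' s0' bp' bt']]]]] := Hz j' jJ'.
  have bb : b = b'.
    apply: (cexp_joukowski_inj (a := a) (a' := a') s0 s0' bp bp').
    by apply: (addIr ('i * h%:C)); rewrite -zE -zE'.
  apply/eqP; rewrite -(eqr_nat R) -subr_eq0; apply: contraT => jj.
  have : `|theta j - theta j'| <= (pi + 1) / n%:R.
    have -> : theta j - theta j' = (b' - theta j') - (b - theta j) by rewrite bb; ring.
    apply: (le_trans (ler_normB _ _)); apply: (le_trans (lerD bt' bt)).
    by rewrite le_eqVlt; apply/orP; left; apply/eqP; field; rewrite gt_eqF.
  have -> : theta j - theta j' = 2 * pi / n%:R * (j%:R - j'%:R) by rewrite /theta; ring.
  have c0 : 0 < 2 * pi / n%:R :> R by rewrite divr_gt0 // mulr_gt0 //; lra.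
  rewrite normrM (gtr0_norm c0).
  have : 1 <= `|j%:R - j'%:R| :> R.
    move: jj; rewrite subr_eq0 eqr_nat => jj.
    wlog lt : j j' {jJ jJ' zz zE zE' bt bt'} jj / (j' < j)%N.
      move=> H; case: (ltngtP j j') => [l|l|l]; [|exact: H|by rewrite l eqxx in jj].
      by rewrite distrC; apply: H => //; rewrite eq_sym.
    by rewrite -natrB ?(ltnW lt) // normr_nat ler1n subn_gt0.
  set D := `|_| => D1.
  have : 2 * pi / n%:R * 1 <= 2 * pi / n%:R * D by rewrite ler_pM2l.
  rewrite mulr1 => /le_trans H /H; rewrite ler_pM2r ?invr_gt0 //; lra.
apply: esum_ge; pose s := map z (index_iota J0 J1).
have us : uniq s by rewrite map_inj_in_uniq // iota_uniq.
exists [set` s].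
  split; first exact: finite_seq.
  move=> y /= /mapP[j]; rewrite mem_index_iota => jJ ->.
  by case: (Hz j jJ).
rewrite -(fsbig_seq _ _ us) big_map sumEFin lee_fin.
rewrite !big_nat; apply: ler_sum => j jJ.
by case: (Hz j jJ) => _ [].
Qed.

Lemma harmonic_ge (J0 J1 : nat) : (0 < J0)%N -> (J0 <= J1)%N ->
  ln (J1%:R / J0%:R) <= \sum_(J0 <= j < J1) (j%:R : R)^-1.
Proof.
move=> J00 /subnKC <-; elim: (J1 - J0)%N => [|d IH].
  by rewrite addn0 divff ?pnatr_eq0 -?lt0n // ln1 big_geq.
rewrite addnS big_nat_recr ?leq_addr //=.
have p0 : 0 < (J0 + d)%:R :> R by rewrite ltr0n addn_gt0 J00.
have q0 : 0 < J0%:R :> R by rewrite ltr0n.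
have -> : (J0 + d).+1%:R / J0%:R = (J0 + d)%:R / J0%:R * (1 + (J0 + d)%:R^-1) :> R.
  rewrite -natr1; move: p0 q0; set x := (J0 + d)%:R; set y := J0%:R => p0 q0.
  by field; rewrite -natrD !gt_eqF.
have v0 : 0 < (J0 + d)%:R^-1 :> R by rewrite invr_gt0.
rewrite lnM ?posrE ?divr_gt0 ?addr_gt0 //.
by apply: lerD => //; apply: le_ln1Dx; lra.
Qed.

Lemma powR_ge_near (s M : R) : 0 < s -> \forall n \near \oo, M <= n%:R `^ s.
Proof.
move=> s0; pose K := Num.max M 1.
have K0 : 0 < K by rewrite lt_max ltr01 orbT.
near=> n; apply: (@le_trans _ _ K); first by rewrite le_max lexx.
have -> : K = (K `^ s^-1) `^ s.
  by rewrite -powRrM mulVf ?gt_eqF // powRr1 // ltW.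
apply: ge0_ler_powR; rewrite ?nnegrE ?powR_ge0 ?(ltW s0) //.
near: n; exact: nbhs_infty_ger.
Unshelve. all: by end_near. Qed.

End Counting.

(** * Asymptotics in [n] *)

Section Asymptotics.
Context {R : realType}.

Lemma leq_mul_div16 n : (32 <= n)%N -> (n <= 32 * (n %/ 16))%N.
Proof. lia. Qed.

(** With [tau = n^(-alpha/8)] all the conditions of [LT_sum_ge] hold for large
    [n]; the restrictive one says that [log n] is small against [n^(1 - alpha)].
    The harmonic sum over [n tau <= j <= n / 16] is then about [- log tau]. *)
Lemma LT_ratio_ge (alpha : R) : 0 < alpha < 1 ->
  \forall n \near \oo, ((alpha / 16 / 272 * ln n%:R)%:E <= LT_ratio alpha n)%E.
Proof.
move=> /andP[a0 a1].
have g0 : 0 < (1 - alpha) / 2 by rewrite divr_gt0 // subr_gt0.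
have d0 : 0 < alpha / 8 by rewrite divr_gt0.
set g := (1 - alpha) / 2 in g0; set d := alpha / 8 in d0.
pose K : R := ln 36 + 4 + 2 / g.
near=> n.
have En : (64 * 64 : R) <= n%:R `^ d by near: n; exact: powR_ge_near.
have Ey1 : 1 <= n%:R `^ g by near: n; exact: powR_ge_near.
have Ey : 12 ^+ 4 * K <= n%:R `^ g by near: n; exact: powR_ge_near.
have n_gt0 : (0 < n)%N by near: n; exact: nbhs_infty_gt.
have n32 : (32 <= n)%N by near: n; exact: nbhs_infty_ge.
have x0 : 0 < n%:R :> R by rewrite ltr0n.
set x : R := n%:R in En Ey1 Ey x0 *.
pose tau := x `^ (- d).
have tau0 : 0 < tau by exact: powR_gt0.
have tauV : tau^-1 = x `^ d by rewrite /tau powRN invrK.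
have lntau : - ln tau = d * ln x by rewrite ln_powR mulNr opprK.
have c0 : 0 < x `^ (- alpha) by exact: powR_gt0.
have hE : tau ^+ 8 = x `^ (- alpha).
  rewrite -powR_mulrn ?powR_ge0 // -powRrM /d; congr (_ `^ _).
  by field.
have tau2 : tau <= (64 * 64)^-1.
  by rewrite -[tau]invrK tauV lef_pV2 ?posrE ?powR_gt0 // mulr_gt0.
have i64 : (64 * 64)^-1 <= 1 / 64 :> R.
  by rewrite mul1r lef_pV2 ?posrE ?mulr_gt0 // ler_peMl // ler1n.
have tau1 : tau <= 1 / 64 by exact: le_trans tau2 i64.
have xg : x * tau ^+ 8 = x `^ g * x `^ g.
  rewrite hE -{1}[x]powRr1 ?(ltW x0) // -!powRD; last 2 first.
  - by rewrite (gt_eqF x0) implybT.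
  - by rewrite (gt_eqF x0) implybT.
  by rewrite /g; congr (_ `^ _); field.
have lnx : ln x <= g^-1 * x `^ g.
  have := ln_sublinear (powR_gt0 g x0); rewrite ln_powR => /ltW.
  by rewrite -ler_pdivlMl ?invr_gt0 ?invrK.
have lnx0 : 0 <= ln x by rewrite ln_ge0 // ler1n.
have lnp : ln (36 / (tau ^+ 8 * tau)) + pi <= x * (tau ^+ 8 / 12 ^+ 4).
  have t9 : 0 < tau ^+ 8 * tau by rewrite mulr_gt0 ?exprn_gt0.
  rewrite lnM ?posrE ?invr_gt0 // lnV ?posrE // -exprSr lnXn //.
  have -> : - (ln tau *+ 9) = 9 * (d * ln x) by rewrite -lntau mulr_natl mulNrn.
  have -> : x * (tau ^+ 8 / 12 ^+ 4) = x `^ g * (x `^ g / 12 ^+ 4).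
    by rewrite mulrA xg -mulrA.
  have yK : K <= x `^ g / 12 ^+ 4 by rewrite ler_pdivlMr ?exprn_gt0 // mulrC.
  have pi4 := @pi_le4 R.
  have d1 : 9 * (d * ln x) <= 2 * ln x.
    have : alpha * ln x <= ln x by rewrite ler_piMl // ltW.
    by rewrite /d; lra.
  have ln36 : 0 <= ln 36 :> R by rewrite ln_ge0 // ler1n.
  have gV : 0 <= 2 / g by rewrite divr_ge0 // ltW.
  have K0 : ln 36 + 4 <= x `^ g * (ln 36 + 4) by rewrite ler_peMl // addr_ge0.
  apply: (@le_trans _ _ (x `^ g * K)); last by rewrite ler_wpM2l // powR_ge0.
  rewrite /K [leRHS]mulrDr; have : 2 * ln x <= x `^ g * (2 / g).
    have -> : x `^ g * (2 / g) = 2 * (g^-1 * x `^ g) by ring.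
    by rewrite ler_pM2l.
  lra.
pose J0 := (Num.truncn (x * tau)).+1.
pose J1 := (n %/ 16)%N.
have xt0 : 0 <= x * tau by rewrite mulr_ge0 // ltW.
have /andP[J0u J0l] := truncn_itv xt0.
have xt1 : 1 <= x * tau.
  have h8 : x * tau ^+ 8 <= x * tau.
    rewrite ler_pM2l // exprS ler_piMr ?(ltW tau0) // expr_le1 ?(ltW tau0) //.
    by apply: (le_trans tau1); lra.
  by apply: le_trans h8; rewrite xg -[leLHS]mulr1 ler_pM.
have J1u : J1%:R <= x / 16.
  by rewrite ler_pdivlMr // -natrM ler_nat leq_trunc_div.
have J1l : x / 32 <= J1%:R.
  have : (n <= 32 * J1)%N by exact: leq_mul_div16.
  by rewrite -(ler_nat R) natrM ler_pdivrMr // mulrC.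
have J0u' : J0%:R <= 2 * (x * tau) by rewrite /J0 -natr1; lra.
have J00 : 0 < J0%:R :> R by rewrite ltr0n.
have ratio : (64 * tau)^-1 <= J1%:R / J0%:R.
  rewrite ler_pdivlMr // mulrC ler_pdivrMr ?mulr_gt0 //.
  apply: (le_trans J0u').
  have : x / 32 * (64 * tau) <= J1%:R * (64 * tau) by rewrite ler_wpM2r // mulr_ge0 // ltW.
  by have -> : x / 32 * (64 * tau) = 2 * (x * tau) by field.
have t64 : 64 * tau <= 1 by lra.
have J01 : (J0 <= J1)%N.
  rewrite -(ler_nat R) -[leLHS]mul1r -ler_pdivlMr //; apply: le_trans ratio.
  by rewrite invf_ge1 // mulr_gt0.
have lnr : alpha / 16 * ln x <= ln (J1%:R / J0%:R).
  have : ln (64 * tau)^-1 <= ln (J1%:R / J0%:R).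
    have rp : 0 < (64 * tau)^-1 by rewrite invr_gt0 mulr_gt0.
    by rewrite ler_ln ?posrE ?(lt_le_trans rp ratio).
  have : ln tau <= ln (64 * 64)^-1 by rewrite ler_ln ?posrE ?invr_gt0 ?mulr_gt0.
  rewrite lnV ?posrE ?mulr_gt0 // lnM ?posrE // lnV ?posrE ?mulr_gt0 // lnM ?posrE //.
  have -> : alpha / 16 * ln x = (d * ln x) / 2 by rewrite /d; field.
  rewrite -lntau; lra.
have nE : n = n.-1.+1 by rewrite prednK.
have lnp' : ln (36 / (tau ^+ 8 * tau)) + pi <= n.-1.+1%:R * (tau ^+ 8 / 12 ^+ 4).
  by rewrite -nE.
have low := @LT_sum_ge R n.-1 tau J0 J1 tau0 tau1 lnp'.
rewrite -nE in low; have {}low := low (ltW J0l) J1u.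
rewrite /LT_ratio.
have -> : trace_norm (J n alpha \- laplacian R)%R = (x * x `^ (- alpha))%:E.
  rewrite -(trace_norm_potential n c0); congr trace_norm; apply/funext => u.
  by rewrite /= addrAC subrr add0r.
rewrite inver mulf_eq0 !gt_eqF //=.
rewrite hE in low.
pose S : R := \sum_(J0 <= j < J1) x `^ (- alpha) * x / 272 / j%:R.
apply: (@le_trans _ _ ((x * x `^ (- alpha))^-1%:E * S%:E)%E); last first.
  by apply: lee_wpmul2l => //; rewrite lee_fin invr_ge0 mulr_ge0 // ltW.
rewrite -EFinM lee_fin /S -mulr_sumr.
have har := @harmonic_ge R J0 J1 isT J01.
have -> : (x * x `^ (- alpha))^-1 * (x `^ (- alpha) * x / 272 * \sum_(J0 <= j < J1) j%:R^-1) =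
   (\sum_(J0 <= j < J1) (j%:R : R)^-1) / 272.
  by field; rewrite !gt_eqF.
have -> : alpha / 16 / 272 * ln x = (alpha / 16 * ln x) / 272 by ring.
by rewrite ler_pM2r // (le_trans lnr).
Unshelve. all: by end_near. Qed.

End Asymptotics.

Theorem theorem0p4 (R : realType) (alpha : R) (halpha : 0 < alpha < 1) :
  (exists2 c : R, 0 < c &
     \forall n \near \oo, ((c * ln n%:R)%:E <= LT_ratio alpha n)%E) /\
  LT_ratio alpha n @[n --> \oo] --> +oo%E.
Proof.
have low := LT_ratio_ge halpha.
have c0 : 0 < alpha / 16 / 272 by case/andP: halpha => a0 _; rewrite !divr_gt0.
split; first by exists (alpha / 16 / 272).
apply/cvgeyPge => A; near=> n.
apply: (@le_trans _ _ (alpha / 16 / 272 * ln n%:R)%:E); last by near: n; exact: low.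
rewrite lee_fin mulrC -ler_pdivrMr //.
have e0 : 0 < expR (A / (alpha / 16 / 272)) by exact: expR_gt0.
have en : expR (A / (alpha / 16 / 272)) <= n%:R by near: n; exact: nbhs_infty_ger.
by rewrite -[leLHS]expRK ler_ln ?posrE // (lt_le_trans e0).
Unshelve. all: by end_near. Qed.
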